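(* Let $f\in\mathbb{Z}[t,t^{-1}]$. There exists a virtual knot $K$ with $f_K(t)=f$ if and only if $f$ can be written as $$f=a_{2n}t^{2n}+a_{2n-2}t^{2n-2}+\cdots+a_{2n-2m}t^{2n-2m}$$ for some integers $n$ and $m\ge 0$ and integers $a_{2n},a_{2n-2},\dots,a_{2n-2m}$ satisfying $$a_{2n}+a_{2n-2}+\cdots+a_{2n-2m}\equiv 0 \pmod 2 .$$ Here $f_K(t)$ is the odd writhe polynomial of $K$.
   Context: All virtual knot diagrams are oriented. A virtual knot diagram is a planar 4-valent graph (the image of one immersed oriented closed curve) in which each vertex is either a real crossing (with over/under information) or a virtual crossing. A virtual knot is an equivalence class of such diagrams under generalized Reidemeister moves: the classical moves $\Omega_1,\Omega_2,\Omega_3$ (on real crossings), their virtual versions $\Omega_1',\Omega_2',\Omega_3'$ (all crossings virtual), and the semivirtual third move $\Omega_3^s$ (a strand with two consecutive virtual crossings passes across a real crossing). The Gauss diagram of a diagram $D$ is an anticlockwise oriented circle with one chord for each real crossing, joining the two preimages of the crossing. Each chord is oriented from the preimage of the overcrossing to the preimage of the undercrossing and carries the sign $w(c)\in\{+1,-1\}$ equal to the writhe of the crossing. Crossings and chords are denoted by the same letter $c$. The over-endpoint of $c$ is $c^+$ and the under-endpoint is $c^-$. Every Gauss diagram arises from some virtual knot diagram, and a Gauss diagram determines its virtual knot uniquely. A chord $c$ (and the real crossing $c$) is odd if the number of endpoints of other chords lying on one (equivalently, on each) of the two open arcs of the circle bounded by $c^+$ and $c^-$ is odd; otherwise it is even.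 $Odd(D)$ is the set of odd crossings. If $D$ has $n$ real crossings, the $2n$ chord endpoints divide the circle into $2n$ arcs. For an arc $a$, choose a point in $a$ and travel once along the circle in its orientation; $N(a)$ is the sum of $w(c)$ over all chords $c$ for which $c^+$ is met before $c^-$. For a chord $c$ define $N(c)\in\mathbb{Z}$ as follows: if $w(c)=+1$, $N(c)=N(\text{arc immediately after }c^-)-N(\text{arc immediately after }c^+)$; if $w(c)=-1$, $N(c)=N(\text{arc immediately before }c^-)-N(\text{arc immediately before }c^+)$, where before/after refer to the orientation of the circle. The odd writhe polynomial of a virtual knot $K$ is $f_K(t)=\sum_{c\in Odd(D)}w(c)\,t^{N(c)}\in\mathbb{Z}[t,t^{-1}]$ for any diagram $D$ of $K$ (equal to $0$ if there are no odd crossings); it does not depend on the choice of $D$. *)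

(* Defs.v *)
From Stdlib Require Import Relation_Operators.
From mathcomp Require Import all_boot all_algebra.
From mathcomp Require Import boolp.
From mathcomp Require Import monalg.

Set Implicit Arguments.
Unset Strict Implicit.
Unset Printing Implicit Defensive.

Import GRing.Theory.
Local Open Scope nat_scope.

(* An oriented virtual knot diagram is recorded by travelling once along its
   curve, from an arbitrary base point, and listing the passages through the
   vertices; every vertex is passed twice.  A passage [p] consists of
   - [vertex p], the name of the vertex;
   - [side p], which is true iff at that vertex the other strand crosses the
     strand of [p] from right to left, i.e. iff (direction of [p], direction of
     the other passage) is a positive basis of the plane;
   - [level p], which is [Some true] (over) or [Some false] (under) at a real
     crossing and [None] at a virtual one.
   The cyclic order of the four edges at each vertex is thus determined. *)
Definition passage : Type := (nat * bool * option bool)%type.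

Definition Passage (c : nat) (s : bool) (l : option bool) : passage :=
  (c, s, l).
Definition vertex (p : passage) : nat := p.1.1.
Definition side (p : passage) : bool := p.1.2.
Definition level (p : passage) : option bool := p.2.

Definition mate (p : passage) : passage :=
  Passage (vertex p) (~~ side p) (omap negb (level p)).

Definition well_paired (D : seq passage) : bool :=
  all (fun p => (count (fun q => vertex q == vertex p) D == 2)
                && (mate p \in D)) D.

(* The dart [(i, true)] is the edge of the curve from the [i]-th passage to the
   next one, and [(i, false)] is the same edge travelled backwards.
   [face_next] follows a dart to the vertex at its end and turns left there, so
   that the orbits of [face_next] are the faces of the 4-valent map. *)
Definition dart (D : seq passage) : finType := ('I_(size D) * bool)%type.

Definition face_next (D : seq passage) (x : dart D) : dart D :=
  let j := if x.2 then ordS x.1 else x.1 in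
  let p := tnth (in_tuple D) j in
  let k := insubd j (index (mate p) D) in
  if x.2 == side p then (k, true) else (ord_pred k, false).

(* Euler's formula V + F = E + 2; the underlying graph is connected.  The
   crossingless circle has no vertex on its only edge and is treated apart. *)
Definition planar (D : seq passage) : bool :=
  (D == [::])
  || ((size D)./2 + fcard (@face_next D) predT == size D + 2).

Definition is_diagram (D : seq passage) : bool := well_paired D && planar D.

Definition diagram : Type := {D : seq passage | is_diagram D}.

(* Two passages made in the order [p], [q] if [o], and [q], [p] otherwise. *)
Definition in_order (o : bool) (p q : passage) : seq passage :=
  if o then [:: p; q] else [:: q; p].

(* Strands 1, 2, 3 bounding a triangle: 1 and 2 meet at [a], 1 and 3 at [b],
   2 and 3 at [c].  [o1], [o2], [o3] say whether strand 1 meets [a] before [b],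
   strand 2 meets [a] before [c] and strand 3 meets [b] before [c].  The sides
   are those for which the triangle is a face, lying to the left of the segment
   from [a] to [b] if [m] holds and to its right otherwise.  Negating all of
   [o1], [o2], [o3] preserves the sides. *)
Definition triangle (m : bool) (l12 l13 l23 : option bool) (a b c : nat)
    (o1 o2 o3 : bool) (X Y Z : seq passage) : seq passage :=
  let p12 := Passage a ((o1 == o2) == m) l12 in
  let p13 := Passage b ((o1 == o3) == m) l13 in
  let p23 := Passage c ((o2 == o3) == m) l23 in
  in_order o1 p12 p13 ++ X ++ in_order o2 (mate p12) p23 ++ Y
    ++ in_order o3 (mate p13) (mate p23) ++ Z.

(* [lij] is the level of strand [i] at its crossing with strand [j].  Three real
   crossings: the strands lie at three different heights (the relation "over"
   is not cyclic).  Three virtual crossings, or one real crossing crossed by a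
   strand with two virtual ones, are allowed; a single virtual crossing is
   not. *)
Definition third_move_levels (l12 l13 l23 : option bool) : bool :=
  match l12, l13, l23 with
  | Some h12, Some h13, Some h23 => (h12 == h23) ==> (h13 == h12)
  | None, None, _ | None, _, None | _, None, None => true
  | _, _, _ => false
  end.

(* [move_rot] and [move_rename] relate codes of one and the same diagram (base
   point, names of the vertices).  In the first two moves the option [l] covers
   the real and the virtual version; [~~ s] in the second move says that the
   two vertices are crossed in opposite directions.  [oe] tells whether the two
   strands of the second move have the same direction. *)
Inductive move : seq passage -> seq passage -> Prop :=
| move_rot k D : move D (rot k D)
| move_rename (h : nat -> nat) D of
    {in map vertex D &, injective h} :
    move D [seq Passage (h (vertex p)) (side p) (level p) | p <- D]
| move_Omega1 c s l X :
    move X ([:: Passage c s l; mate (Passage c s l)] ++ X)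
| move_Omega2 c d s l oe X Y :
    let p := Passage c s l in
    let q := Passage d (~~ s) l in
    move (X ++ Y) ([:: p; q] ++ X ++ in_order oe (mate p) (mate q) ++ Y)
| move_Omega3 m l12 l13 l23 a b c o1 o2 o3 X Y Z of
    third_move_levels l12 l13 l23 :
    move (triangle m l12 l13 l23 a b c o1 o2 o3 X Y Z)
         (triangle m l12 l13 l23 a b c (~~ o1) (~~ o2) (~~ o3) X Y Z).

(* Every diagram in a chain of moves is a genuine planar diagram. *)
Definition equivalent : diagram -> diagram -> Prop :=
  clos_refl_sym_trans diagram (fun D E => move (val D) (val E)).

Definition equivalentb (D E : diagram) : bool := `[< equivalent D E >].

Lemma equivalentb_refl : reflexive equivalentb.
Proof. by move=> D; apply/asboolP; apply: rst_refl. Qed.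

Lemma equivalentb_sym : symmetric equivalentb.
Proof. by move=> D E; apply/asboolP/asboolP; apply: rst_sym. Qed.

Lemma equivalentb_trans : transitive equivalentb.
Proof.
move=> E D F /asboolP DE /asboolP EF; apply/asboolP.
exact: rst_trans DE EF.
Qed.

Canonical equivalentb_equiv :=
  EquivRel equivalentb equivalentb_refl equivalentb_sym equivalentb_trans.

Definition virtual_knot : Type := {eq_quot equivalentb}%qT.

(* A Gauss diagram is the list of chord endpoints met when travelling once
   along the circle.  An endpoint [e] carries the name of its chord, whether it
   is the over-endpoint, and whether the chord has sign +1. *)
Definition endpoint : Type := (nat * bool * bool)%type.

Definition chord (e : endpoint) : nat := e.1.1.
Definition is_over (e : endpoint) : bool := e.1.2.

(* A real crossing is positive iff (over direction, under direction) is a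
   positive basis, that is, iff the over-passage has side [true]. *)
Definition gauss_endpoint (p : passage) : option endpoint :=
  omap (fun o : bool => (vertex p, o, o == side p)) (level p).

Definition gauss_diagram (D : seq passage) : seq endpoint :=
  pmap gauss_endpoint D.

Definition chords (G : seq endpoint) : seq nat := undup (map chord G).

(* Position on the circle of c^+ ([o = true]) or c^- ([o = false]). *)
Definition pos (G : seq endpoint) (c : nat) (o : bool) : nat :=
  find (fun e => (chord e == c) && (is_over e == o)) G.

Local Open Scope ring_scope.

Definition writhe (G : seq endpoint) (c : nat) : int :=
  if (c, true, true) \in G then 1 else -1.

(* The endpoints on the open arc bounded by c^+ and c^- that does not contain
   the base point. *)
Definition open_arc (G : seq endpoint) (c : nat) : seq endpoint :=
  let i := minn (pos G c true) (pos G c false) in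
  let j := maxn (pos G c true) (pos G c false) in
  drop i.+1 (take j G).

Definition odd_chord (G : seq endpoint) (c : nat) : bool :=
  odd (size (open_arc G c)).

(* The arc number [k] is the one just before the endpoint at position [k]; arc
   number [size G] is arc number 0.  [rot k G] lists the endpoints in the order
   in which they are met from a point of that arc. *)
Definition arc_index (G : seq endpoint) (k : nat) : int :=
  \sum_(c <- chords G | (pos (rot k G) c true < pos (rot k G) c false)%N)
    writhe G c.

Definition chord_index (G : seq endpoint) (c : nat) : int :=
  if writhe G c == 1
  then arc_index G (pos G c false).+1 - arc_index G (pos G c true).+1
  else arc_index G (pos G c false) - arc_index G (pos G c true).

(* Z[t, t^-1]: finitely supported families of integers indexed by the exponents;
   [<< a *g k >>] is the Laurent monomial a t^k. *)
Definition laurent : Type := {malg int[int]}.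

Definition gauss_polynomial (G : seq endpoint) : laurent :=
  \sum_(c <- chords G | odd_chord G c) << writhe G c *g chord_index G c >>.

Definition diagram_polynomial (D : diagram) : laurent :=
  gauss_polynomial (gauss_diagram (val D)).

(* [repr K] is some diagram of [K]; by invariance, any other one would do. *)
Definition odd_writhe_polynomial (K : virtual_knot) : laurent :=
  diagram_polynomial (repr K).

(* Main.v *)
Require Import Defs.
From mathcomp Require Import all_boot all_algebra monalg.
From Stdlib Require Import Relation_Operators.
From mathcomp Require Import boolp zify ring.

(** Move a base point along the Gauss diagram and record a height that goes down
at the passages with side [true] and up at the others.  The height is [arc_index]
up to a constant (arc_indexE), and the index of a chord is one plus the difference
of the low heights of its under- and over-endpoints (chord_indexE).  Heights have
the parity of positions, so a chord is odd exactly when its index is even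
(odd_chordE): the odd writhe polynomial is the part with even exponents of the sum
of the monomials of all chords.

Necessity.  Odd chords have even index, so only even exponents occur; and the number
of odd chords is even because half of the endpoints sit at odd positions (even_chords).

Sufficiency.  The polynomial is a sum over pairs of endpoints with the same name,
and depends on the low heights only up to a common translation; this makes its
invariance under the moves a local computation (move_polynomial), so that it may be
computed on any diagram of a knot.  It is additive under connected sum.  Summing
with a suitable virtual twist knot adds [t^(2k)] or [- t^(2k)], for any [k], and an
odd constant; other twist knots add 2 or -2 (twist_clasp_polynomial).  Any sum with
even total coefficient is made of these.

The twist knots must be planar diagrams.  They are built from a trefoil by
repeatedly replacing a crossing of the twist region by three, and the faces are
followed through the two operations (has_faces_trefoil, has_faces_triple): a
labelling of the darts by faces is carried along, with two or three new labels, and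
Euler's formula is preserved. *)

Set Implicit Arguments.
Unset Strict Implicit.
Unset Printing Implicit Defensive.

Import GRing.Theory.
Local Open Scope ring_scope.

(** * Heights on a Gauss diagram and the index sum *)

Definition flip (e : endpoint) : endpoint := (chord e, ~~ is_over e, e.2).

(** Over-endpoints of positive chords and under-endpoints of negative ones are the
passages crossed from right to left, so this is the side of the passage that
produces [e]. *)
Definition endpoint_side (e : endpoint) : bool := is_over e == e.2.

(** What is added to [arc_index] when the base point moves past [e].  It depends on
the side only: exchanging over and under negates both the sign of the chord and
the order of its endpoints. *)
Definition jump (e : endpoint) : int := if endpoint_side e then -1 else 1.

(** Each endpoint is paired with the lower of the heights of the two arcs around it,
where the height starts at [h] and changes by [jump]. *)
Fixpoint lows (h : int) (G : seq endpoint) : seq (endpoint * int) :=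
  if G is e :: G' then (e, h - (endpoint_side e)%:Z) :: lows (h + jump e) G' else [::].

Definition rise (G : seq endpoint) : int := \sum_(e <- G) jump e.

(** Odd chords are exactly those with an even index, so the parity test can be
carried by the monomial. *)
Definition even_monomial (s : bool) (n : int) : laurent :=
  if (2 %| n)%Z then << (if s then 1 else -1) *g n >> else 0.

(** The double sum is over pairs and not over positions, hence depends on [L] only up
to permutation and up to a common shift of the heights; all the moves act on [L]
in this way. *)
Definition index_sum (L : seq (endpoint * int)) : laurent :=
  \sum_(x <- L | is_over x.1)
    \sum_(y <- L | y.1 == flip x.1) even_monomial x.1.2 (1 + y.2 - x.2).

Lemma flipK : involutive flip.
Proof. by case=> [[c o] s]; rewrite /flip /chord /is_over /= negbK. Qed.

Lemma endpoint_side_flip e : endpoint_side (flip e) = ~~ endpoint_side e.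
Proof. by case: e => [[c []] []]. Qed.

Lemma jump_flip e : jump (flip e) = - jump e.
Proof. by rewrite /jump endpoint_side_flip; case: (endpoint_side e). Qed.

Lemma flip_neq e : flip e != e.
Proof. by case: e => [[c []] s]; rewrite /flip /chord /is_over /= !xpair_eqE /= andbF. Qed.

Lemma lows_cat h G1 G2 :
  lows h (G1 ++ G2) = lows h G1 ++ lows (h + rise G1) G2.
Proof.
elim: G1 h => [|e G IH] h /=; first by rewrite /rise big_nil addr0.
by rewrite IH /rise big_cons addrA.
Qed.

(** A change of base point only translates the heights. *)
Lemma lows_shift h d G :
  lows (h + d) G = [seq (x.1, x.2 + d) | x <- lows h G].
Proof.
elim: G h => [|e G IH] h //=; rewrite addrAC; congr (_ :: _).
by rewrite -IH; congr (lows _ _); rewrite addrAC.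
Qed.

Lemma lows_endpoints h G : [seq x.1 | x <- lows h G] = G.
Proof. by elim: G h => [|e G IH] h //=; rewrite IH. Qed.

Lemma rise_cat G1 G2 : rise (G1 ++ G2) = rise G1 + rise G2.
Proof. by rewrite /rise big_cat. Qed.

Lemma index_sum_perm L1 L2 : perm_eq L1 L2 -> index_sum L1 = index_sum L2.
Proof.
move=> L12; rewrite /index_sum (perm_big _ L12); apply: eq_bigr => x _.
exact: perm_big.
Qed.

Lemma index_sum_shift d L : index_sum [seq (x.1, x.2 + d) | x <- L] = index_sum L.
Proof.
rewrite /index_sum big_map; apply: eq_bigr => x _; rewrite big_map.
by apply: eq_bigr => y _ /=; congr even_monomial; ring.
Qed.

Lemma index_sum_map (h : endpoint -> endpoint) L :
    (forall e, is_over (h e) = is_over e) -> (forall e, (h e).2 = e.2) ->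
    {in L &, forall x y, (h y.1 == flip (h x.1)) = (y.1 == flip x.1)} ->
  index_sum [seq (h x.1, x.2) | x <- L] = index_sum L.
Proof.
move=> hO hS hF; rewrite /index_sum big_map /= big_seq_cond [RHS]big_seq_cond.
apply: eq_big => [x | x /andP[xL _]]; first by rewrite hO.
rewrite big_map big_seq_cond [RHS]big_seq_cond hS.
by apply: eq_bigl => y /=; case yL: (y \in L) => //=; rewrite hF.
Qed.

Lemma index_sum_cat L1 L2 :
    {in L1 & L2, forall x y, chord x.1 != chord y.1} ->
  index_sum (L1 ++ L2) = index_sum L1 + index_sum L2.
Proof.
move=> dis; rewrite /index_sum big_cat /=; congr (_ + _).
- rewrite big_seq_cond [RHS]big_seq_cond; apply: eq_bigr => x /andP[xL _].
  rewrite big_cat /= [X in _ + X]big1_seq ?addr0 // => y /andP[/eqP yx yL].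
  by have := dis _ _ xL yL; rewrite yx eqxx.
rewrite big_seq_cond [RHS]big_seq_cond; apply: eq_bigr => x /andP[xL _].
rewrite big_cat /= [X in X + _]big1_seq ?add0r // => y /andP[/eqP yx yL].
by have := dis _ _ yL xL; rewrite yx eqxx.
Qed.

(** Whichever endpoint of the chord comes first, the under-height minus the
over-height enters. *)
Lemma index_sum_pair e x y :
  index_sum [:: (e, x); (flip e, y)] =
  even_monomial e.2 (1 + (if is_over e then y - x else x - y)).
Proof.
have eN := flip_neq e; have eN' : e != flip e by rewrite eq_sym.
have over_flip : is_over (flip e) = ~~ is_over e by case: (e) => [[]].
rewrite /index_sum !big_cons !big_nil [fst _]/= [fst (flip e, _)]/= over_flip.
rewrite flipK !eqxx (negbTE eN) (negbTE eN') /=.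
by case: (is_over e) => /=; rewrite !addr0 addrA.
Qed.

(** * Well formed Gauss diagrams *)

Definition gauss_wf (G : seq endpoint) : Prop :=
  [/\ uniq G, {in G, forall e, flip e \in G}
    & {in G &, forall e e', chord e = chord e' -> e' = e \/ e' = flip e}].

Lemma mateK : involutive mate.
Proof. by case=> [[c s] [[]|]]; rewrite /mate /= negbK. Qed.

Lemma mate_neq p : mate p != p.
Proof.
by case: p => [[c []] l]; rewrite /mate /Passage /vertex /side /= !xpair_eqE /= andbF.
Qed.

Lemma well_paired_uniq D : well_paired D -> uniq D.
Proof.
move=> /allP wD; apply: count_mem_uniq => p.
have [pD|/count_memPn //] := boolP (p \in D).
have /andP[/eqP c2 mD] := wD p pD.
have : (count_mem p D + count_mem (mate p) D <= 2)%N.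
  rewrite -c2 -count_predUI [X in (_ + X)%N](_ : _ = 0%N).
    rewrite addn0; apply: sub_count => q /=.
    by move=> /orP[] /eqP ->.
  apply/eqP; rewrite -leqn0 leqNgt -has_count; apply/hasPn => q _ /=.
  apply/negP=> /andP[/eqP -> /eqP h]; have := mate_neq p.
  by rewrite -h eqxx.
have : (0 < count_mem p D)%N by rewrite -has_count has_pred1.
have : (0 < count_mem (mate p) D)%N by rewrite -has_count has_pred1.
case: (p \in D) pD => // _; lia.
Qed.

Lemma well_pairedP D :
  reflect [/\ uniq D, {in D, forall p, mate p \in D}
    & {in D &, forall p q, vertex p = vertex q -> q = p \/ q = mate p}]
    (well_paired D).
Proof.
apply: (iffP idP) => [wD | [uD mD eD]].
- have uD := well_paired_uniq wD; move/allP: wD => wD.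
  split=> // [p /wD/andP[] // | p q pD qD pq].
  have /andP[/eqP c2 mD] := wD p pD.
  have uu : uniq [:: p; mate p].
    by rewrite /= inE eq_sym mate_neq.
  pose s := [seq q <- D | vertex q == vertex p].
  have sub : {subset [:: p; mate p] <= s}.
    by move=> x; rewrite !inE mem_filter => /orP[] /eqP ->; rewrite eqxx ?pD ?mD.
  have sz : (size s <= 2)%N by rewrite size_filter c2.
  have [_ /(_ q)] := uniq_min_size uu sub sz.
  have -> : q \in s by rewrite mem_filter qD pq eqxx.
  by rewrite !inE => /orP[] /eqP ->; [left | right].
apply/allP => p pD; rewrite mD // andbT -size_filter.
have uu : uniq [:: p; mate p] by rewrite /= inE eq_sym mate_neq.
rewrite (perm_size (uniq_perm (filter_uniq _ uD) uu _)) // => q.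
rewrite mem_filter !inE; apply/andP/orP => [[/eqP qp qD] | [] /eqP ->].
- by have [->|->] := eD p q pD qD (esym qp); [left | right].
- by rewrite eqxx.
by rewrite eqxx mD.
Qed.

Lemma gauss_diagram_cat D E :
  gauss_diagram (D ++ E) = gauss_diagram D ++ gauss_diagram E.
Proof. exact: pmap_cat. Qed.

(** The real passage that an endpoint comes from; the side is recovered from the
sign. *)
Definition lift_endpoint (e : endpoint) : passage :=
  Passage (chord e) (endpoint_side e) (Some (is_over e)).

Lemma lift_endpointK : pcancel lift_endpoint gauss_endpoint.
Proof. by case=> [[c []] []]. Qed.

Lemma gauss_endpoint_lift p e : gauss_endpoint p = Some e -> p = lift_endpoint e.
Proof. by case: p => [[c []] [[]|]] //= [<-]. Qed.

Lemma lift_flip e : lift_endpoint (flip e) = mate (lift_endpoint e).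
Proof. by case: e => [[c []] []]. Qed.

Lemma mem_gauss_diagram D e : (e \in gauss_diagram D) = (lift_endpoint e \in D).
Proof.
rewrite mem_pmap; apply/mapP/idP => [[p pD /esym/gauss_endpoint_lift <-] // | eD].
by exists (lift_endpoint e); rewrite ?lift_endpointK.
Qed.

Lemma gauss_diagram_wf D : well_paired D -> gauss_wf (gauss_diagram D).
Proof.
move=> /well_pairedP[uD mD eD]; split.
- rewrite /gauss_diagram.
  elim: D uD {mD eD} => [|p D IH] //= /andP[pD uD].
  case E: (gauss_endpoint p) => [e|] /=; last exact: IH.
  rewrite IH // andbT; apply: contra pD.
  by rewrite -/(gauss_diagram D) mem_gauss_diagram (gauss_endpoint_lift E).
- by move=> e; rewrite !mem_gauss_diagram lift_flip; apply: mD.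
move=> e e'; rewrite !mem_gauss_diagram => ed ed' cc.
have [] := eD _ _ ed ed' cc; rewrite -?lift_flip.
  by move/(congr1 gauss_endpoint); rewrite !lift_endpointK => -[]; left.
by move/(congr1 gauss_endpoint); rewrite !lift_endpointK => -[]; right.
Qed.

(** * The odd writhe polynomial as an index sum *)

Definition height (G : seq endpoint) (k : nat) : int := rise (take k G).

Lemma index_rot (T : eqType) (s : seq T) k x :
    uniq s -> x \in s -> (k <= size s)%N ->
  index x (rot k s) =
    (if k <= index x s then index x s - k else index x s + size s - k)%N.
Proof.
move=> us xs ks; rewrite /rot index_cat size_drop.
have := us; rewrite -{1}(cat_take_drop k s) cat_uniq => /and3P[_ /hasPn dis _].
have := xs; rewrite -{1}(cat_take_drop k s) mem_cat => /orP[] xk.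
- have xd : x \in drop k s = false by apply/negP => /dis; rewrite /= xk.
  rewrite xd; have lt : (index x s < k)%N by rewrite in_take_leq in xk.
  rewrite leqNgt lt /=.
  have -> : index x (take k s) = index x s.
    by rewrite -{2}(cat_take_drop k s) index_cat xk.
  by lia.
have xt : x \in take k s = false by apply/negbTE/dis.
have -> : index x s = (k + index x (drop k s))%N.
  by rewrite -{1}(cat_take_drop k s) index_cat xt size_takel.
by rewrite xk leq_addr addKn.
Qed.

Section WellFormed.

Variable G : seq endpoint.
Hypothesis wfG : gauss_wf G.

Lemma big_chords (R : nmodType) (F : endpoint -> R) :
  \sum_(e <- G) F e = \sum_(e <- G | is_over e) (F e + F (flip e)).
Proof.
have [uG flG _] := wfG.
rewrite (bigID is_over) big_split /=; congr (_ + _).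
rewrite -[RHS]big_filter -(big_map flip xpredT F) -big_filter; apply: perm_big.
apply: uniq_perm; first exact: filter_uniq.
  by rewrite map_inj_uniq ?filter_uniq //; apply: (can_inj flipK).
move=> e; rewrite mem_filter -[RHS](mem_map (can_inj flipK)) -map_comp.
rewrite (eq_map (_ : _ =1 id)); last by move=> x; apply: flipK.
rewrite map_id mem_filter; congr (_ && _).
by apply/idP/idP => [/flG // | /flG]; rewrite flipK.
Qed.

Lemma index_flip_neq e : e \in G -> index e G != index (flip e) G.
Proof.
have [_ flG _] := wfG => eG.
apply/negP => /eqP /(congr1 (nth e G)); rewrite !nth_index ?flG // => ee.
by have := flip_neq e; rewrite -ee eqxx.
Qed.

Lemma rise_wf : rise G = 0.
Proof.
by rewrite /rise big_chords big1 // => e _; rewrite jump_flip addrN.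
Qed.

Lemma perm_chords : perm_eq (chords G) [seq chord e | e <- G & is_over e].
Proof.
have [uG flG eqG] := wfG.
apply: uniq_perm; first exact: undup_uniq.
- rewrite map_inj_in_uniq ?filter_uniq // => e e'.
  rewrite !mem_filter => /andP[oe eG] /andP[oe' eG'] cc.
  have [// | ee] := eqG e e' eG eG' cc.
  by move: oe'; rewrite ee /flip /is_over /= -/(is_over e) oe.
move=> c; rewrite mem_undup; apply/mapP/mapP => [[e eG ->] | [e]].
- case oe: (is_over e); first by exists e; rewrite ?mem_filter ?oe.
  by exists (flip e); rewrite // mem_filter flG // /flip /is_over /= -/(is_over e) oe.
by rewrite mem_filter => /andP[_ eG] ->; exists e.
Qed.

Lemma pos_index H o e :
    perm_eq H G -> e \in G -> is_over e -> 
  pos H (chord e) o = index (if o then e else flip e) H.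
Proof.
move=> HG eG oe; have [uG flG eqG] := wfG.
rewrite /pos /index; apply: eq_in_find => e'; rewrite (perm_mem HG) => eG' /=.
apply/andP/eqP => [[/eqP cc /eqP <-] | ->].
  have [->|->] := eqG e e' eG eG' (esym cc); first by rewrite oe.
  by rewrite /flip /is_over /= -/(is_over e) oe.
by case: o => //; rewrite /flip /is_over /= -/(is_over e) oe /chord /= eqxx.
Qed.

Lemma writhe_endpoint e :
  e \in G -> is_over e -> writhe G (chord e) = if e.2 then 1 else -1.
Proof.
move=> eG oe; have [uG flG eqG] := wfG.
have eE : e = (chord e, true, e.2) by case: e oe {eG} => [[c o] s]; rewrite /is_over /= => ->.
rewrite /writhe; case E: (_ \in G).
  have [|/(congr1 (fun x => x.2)) /= <- // | ] := eqG _ _ eG E => //.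
  by rewrite eE.
case s: e.2 => //; by rewrite eE s E in eG.
Qed.

Lemma heightE k :
  height G k = \sum_(e <- G | (index e G < k)%N) jump e.
Proof.
have [uG _ _] := wfG; rewrite /height /rise -[RHS]big_filter; apply: perm_big.
apply: uniq_perm; rewrite ?take_uniq ?filter_uniq // => e.
rewrite mem_filter andbC; case eG: (e \in G); first by rewrite in_take.
by apply/negbTE; apply: contraFN eG => /mem_take.
Qed.

Lemma height_succ e : e \in G ->
  height G (index e G).+1 = height G (index e G) + jump e.
Proof.
move=> eG; rewrite /height (take_nth e) ?index_mem // -cats1 rise_cat.
by rewrite nth_index // [rise [:: e]]big_seq1.
Qed.

(** A chord counts for arc [k] according to the order of its endpoints from the base
point, corrected by whether each of them lies before [k]; summing the two
corrections over all chords gives the height. *)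
Lemma arc_indexE k : (k <= size G)%N ->
  arc_index G k = height G k + arc_index G 0.
Proof.
move=> ks; have [uG flG eqG] := wfG.
have key j : (j <= size G)%N -> arc_index G j = \sum_(e <- G | is_over e)
   (if e.2 then 1 else -1) * ((index e G < index (flip e) G)%N%:Z
      - (index e G < j)%N%:Z + (index (flip e) G < j)%N%:Z).
  move=> js; rewrite /arc_index big_mkcond (perm_big _ perm_chords) big_map big_filter.
  rewrite big_seq_cond [RHS]big_seq_cond; apply: eq_bigr => e /andP[eG oe].
  have pr : perm_eq (rot j G) G by rewrite perm_rot.
  rewrite !(pos_index _ pr eG oe) writhe_endpoint //= !index_rot ?flG //.
  have iN := index_flip_neq eG.
  have i1 : (index e G < size G)%N by rewrite index_mem.
  have i2 : (index (flip e) G < size G)%N by rewrite index_mem flG.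
  move: iN i1 i2 js; move: (index e G) (index (flip e) G) (size G) => i i' n.
  move=> iN i1 i2 js.
  case: (leqP j i) => ji; case: (leqP j i') => ji'; case: (ltnP i i') => ii' /=;
    case: ltnP; case: (e.2); lia.
rewrite !key // heightE [X in _ = X + _]big_mkcond big_chords -big_split /=.
rewrite big_seq_cond [RHS]big_seq_cond; apply: eq_bigr => e /andP[eG oe].
rewrite jump_flip /jump /endpoint_side oe.
by case: e.2; case: (index e G < k)%N; case: (_ < k)%N => /=; lia.
Qed.

Definition low (e : endpoint) : int := height G (index e G) - (endpoint_side e)%:Z.

Lemma lowsE : lows 0 G = [seq (e, low e) | e <- G].
Proof.
have [uG _ _] := wfG.
suff H G1 G2 : G = G1 ++ G2 -> lows (rise G1) G2 = [seq (e, low e) | e <- G2].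
  by have := H [::] G erefl; rewrite /rise big_nil.
elim: G2 G1 => [|e G2 IH] G1 //= GE.
have iE : index e G = size G1.
  move: uG; rewrite GE cat_uniq /= => /and3P[_ /norP[eG1 _] _].
  by rewrite index_cat (negbTE eG1) /= eqxx addn0.
congr (_ :: _); first by rewrite /low /height iE GE take_size_cat.
rewrite -(IH (rcons G1 e)) ?cat_rcons //; congr lows.
by rewrite -cats1 rise_cat [rise [:: e]]big_seq1.
Qed.

Lemma index_sumE :
  index_sum (lows 0 G)
  = \sum_(e <- G | is_over e) even_monomial e.2 (1 + low (flip e) - low e).
Proof.
have [uG flG _] := wfG.
rewrite /index_sum lowsE big_map big_seq_cond [RHS]big_seq_cond /=.
apply: eq_bigr => e /andP[eG _].
rewrite big_map (big_rem (flip e)) ?flG //= eqxx big1_seq ?addr0 //= => e'.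
by rewrite mem_rem_uniq // !inE => /andP[/eqP -> ]; rewrite eqxx.
Qed.

(** Each step changes the height by one. *)
Lemma height_parity k : (k <= size G)%N -> (2 %| height G k - k%:Z)%Z.
Proof.
rewrite /height; elim: k => [|k IH] ks; first by rewrite take0 /rise big_nil.
have /IH {IH} : (k <= size G)%N by lia.
have x0 : endpoint by case: (G) ks => [|e ?] //.
rewrite (take_nth x0) // -cats1 rise_cat [rise [:: _]]big_seq1 /jump.
by case: ifP; lia.
Qed.

(** For both signs, the prescribed arc next to the over-endpoint is the lower of the
two around it, and the one next to the under-endpoint is the higher one; hence
the 1. *)
Lemma chord_indexE e : e \in G -> is_over e ->
  chord_index G (chord e) = 1 + low (flip e) - low e.
Proof.
move=> eG oe; have [uG flG eqG] := wfG.
rewrite /chord_index writhe_endpoint // !(pos_index _ (perm_refl _) eG oe).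
have i1 : (index e G < size G)%N by rewrite index_mem.
have i2 : (index (flip e) G < size G)%N by rewrite index_mem flG.
rewrite /low endpoint_side_flip; have -> : endpoint_side e = e.2 by rewrite /endpoint_side oe; case: e.2.
rewrite (arc_indexE i1) (arc_indexE i2) (arc_indexE (ltnW i1)) (arc_indexE (ltnW i2)).
rewrite (height_succ eG) (height_succ (flG e eG)) jump_flip /jump /endpoint_side oe.
by case: e.2 => /=; lia.
Qed.

(** By the parity of heights, the index is even iff the positions of the two
endpoints have the same parity, and then an odd number of endpoints lies
between them. *)
Lemma odd_chordE e : e \in G -> is_over e ->
  odd_chord G (chord e) = (2 %| 1 + low (flip e) - low e)%Z.
Proof.
move=> eG oe; have [uG flG eqG] := wfG.
rewrite /odd_chord /open_arc !(pos_index _ (perm_refl _) eG oe) /=.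
have i1 : (index e G < size G)%N by rewrite index_mem.
have i2 : (index (flip e) G < size G)%N by rewrite index_mem flG.
have iN := index_flip_neq eG.
have h1 := height_parity (ltnW i1); have h2 := height_parity (ltnW i2).
rewrite size_drop size_takel; last by rewrite geq_max (ltnW i1) (ltnW i2).
rewrite /low endpoint_side_flip; case: (endpoint_side e) => /=; move: h1 h2 iN; lia.
Qed.

Lemma gauss_polynomialE : gauss_polynomial G = index_sum (lows 0 G).
Proof.
rewrite index_sumE /gauss_polynomial big_mkcond (perm_big _ perm_chords) big_map.
rewrite big_filter big_seq_cond [RHS]big_seq_cond; apply: eq_bigr => e /andP[eG oe].
by rewrite odd_chordE // writhe_endpoint // chord_indexE.
Qed.

End WellFormed.

(** * Invariance under the generalized Reidemeister moves *)

Lemma gauss_wf_remove H e G :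
    gauss_wf H -> perm_eq H (e :: flip e :: G) ->
  gauss_wf G /\ {in G, forall e', chord e != chord e'}.
Proof.
move=> [uH flH eqH] HG; have memH := perm_mem HG.
move: (uH); rewrite (perm_uniq HG) /= inE => /and3P[/norP[_ eG] feG uG].
have eH : e \in H by rewrite memH mem_head.
have GH e' : e' \in G -> e' \in H by rewrite memH !inE => ->; rewrite !orbT.
have dis : {in G, forall e', chord e != chord e'}.
  move=> e' e'G; apply/eqP => cc.
  by have [ee|ee] := eqH e e' eH (GH _ e'G) cc; [move: eG | move: feG]; rewrite -ee e'G.
split=> //; split=> // [e' e'G | e1 e2 e1G e2G]; last by apply: eqH; apply: GH.
have /flH := GH _ e'G; rewrite memH !inE => /or3P[/eqP ee|/eqP ee|//].
  by have := dis _ e'G; rewrite -ee /flip /chord /= eqxx.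
by have := dis _ e'G; rewrite -(flipK e) -ee flipK /chord /= eqxx.
Qed.

Lemma index_sum_remove L e x y L' :
    gauss_wf [seq z.1 | z <- L] -> perm_eq L ((e, x) :: (flip e, y) :: L') ->
  index_sum L =
    even_monomial e.2 (1 + (if is_over e then y - x else x - y)) + index_sum L'
  /\ gauss_wf [seq z.1 | z <- L'].
Proof.
move=> wfL LL'; have /= pE := perm_map fst LL'.
have [wfL' dis] := gauss_wf_remove wfL pE; split=> //.
rewrite (index_sum_perm LL') -index_sum_pair.
apply: (@index_sum_cat [:: (e, x); (flip e, y)]) => z z'.
rewrite !inE => /orP[] /eqP -> z'L /=; first exact/dis/map_f.
by apply: (dis z'.1); apply: map_f.
Qed.

Lemma lows_map (g : endpoint -> endpoint) h G : (forall e, endpoint_side (g e) = endpoint_side e) ->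
  lows h (map g G) = [seq (g x.1, x.2) | x <- lows h G].
Proof. by move=> gS; elim: G h => [|e G IH] h //=; rewrite IH /jump !gS. Qed.

Lemma mem_lows h G x : x \in lows h G -> x.1 \in G.
Proof. by move=> xL; rewrite -(lows_endpoints h G) map_f. Qed.

Definition code_polynomial (D : seq passage) : laurent :=
  index_sum (lows 0 (gauss_diagram D)).

Lemma diagram_polynomialE (D : diagram) :
  diagram_polynomial D = code_polynomial (val D).
Proof.
case: D => D dD; have /andP[wD _] := dD.
exact: gauss_polynomialE (gauss_diagram_wf wD).
Qed.

Lemma code_polynomial_rot k D :
  well_paired D -> code_polynomial (rot k D) = code_polynomial D.
Proof.
move=> /gauss_diagram_wf/rise_wf; rewrite -{1 3}(cat_take_drop k D) /rot.
rewrite /code_polynomial !gauss_diagram_cat rise_cat !lows_cat !add0r.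
set X := gauss_diagram (take k D); set Y := gauss_diagram (drop k D) => XY0.
have yE : rise Y = 0 + - rise X by rewrite add0r; apply/eqP; rewrite -addr_eq0 addrC XY0.
(* The total rise is zero: starting at the second half lowers it by [rise X]. *)
rewrite -(index_sum_shift (- rise X) (lows 0 X ++ _)) map_cat -!lows_shift.
by rewrite -yE addrN; apply: index_sum_perm; rewrite perm_catC.
Qed.

Lemma code_polynomial_rename (h : nat -> nat) D :
    {in map vertex D &, injective h} ->
  code_polynomial [seq Passage (h (vertex p)) (side p) (level p) | p <- D]
  = code_polynomial D.
Proof.
move=> hI; pose g (e : endpoint) : endpoint := (h (chord e), is_over e, e.2).
have -> : code_polynomial [seq Passage (h (vertex p)) (side p) (level p) | p <- D]
    = index_sum (lows 0 (map g (gauss_diagram D))).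
  congr (index_sum (lows 0 _)); rewrite /gauss_diagram.
  by elim: D {hI} => [|[[c s] [o|]] D /= ->].
have chE x : x \in lows 0 (gauss_diagram D) -> chord x.1 \in map vertex D.
  move/mem_lows; rewrite mem_gauss_diagram => xD.
  by apply/mapP; exists (lift_endpoint x.1).
rewrite lows_map //; apply: index_sum_map => // x y /chE xD /chE yD.
rewrite /g /flip /=; case: (y.1) yD => [[c o] s] yD; rewrite !xpair_eqE /=.
by rewrite (inj_in_eq hI).
Qed.

Lemma rise_pair e e' : rise [:: e; e'] = jump e + jump e'.
Proof. by rewrite /rise !big_cons big_nil addr0. Qed.

Lemma even_monomialN s n : even_monomial (~~ s) n = - even_monomial s n.
Proof.
rewrite /even_monomial; case: ifP => _; last by rewrite oppr0.
by rewrite -monalgUN; case: s => /=; rewrite ?opprK.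
Qed.

(** The two endpoints are adjacent and have opposite jumps, so they have the same low
height: the new chord has index 1, which is odd, and nothing else moves. *)
Lemma code_polynomial_Omega1 c s l X :
    well_paired ([:: Passage c s l; mate (Passage c s l)] ++ X) ->
  code_polynomial ([:: Passage c s l; mate (Passage c s l)] ++ X) = code_polynomial X.
Proof.
move=> /gauss_diagram_wf; rewrite /code_polynomial; case: l => [o|] //.
have -> : gauss_diagram ([:: Passage c s (Some o); mate (Passage c s (Some o))] ++ X)
   = let e := (c, o, o == s) in e :: flip e :: gauss_diagram X.
  by case: o; case: s.
set e := (c, o, o == s) => /= wfG.
rewrite jump_flip endpoint_side_flip addrK.
rewrite -(lows_endpoints 0 (gauss_diagram X)) in wfG.
have [-> _] := @index_sum_remove [:: (e, 0 - (endpoint_side e)%:Z),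
   (flip e, 0 + jump e - (~~ endpoint_side e)%:Z) & lows 0 (gauss_diagram X)] e _ _ _ wfG (perm_refl _).
rewrite [even_monomial _ _](_ : _ = 0) ?add0r // /even_monomial /jump.
by case: (is_over e); case: (endpoint_side e); case: ifP => //= h; exfalso; move: h; lia.
Qed.

(** Exchanging two neighbouring endpoints changes the height of each by the jump of
the other. *)
Lemma lows_in_order h o e e' :
  perm_eq (lows h (if o then [:: e; e'] else [:: e'; e]))
    [:: (e, h - (endpoint_side e)%:Z + (if o then 0 else jump e'));
        (e', h - (endpoint_side e')%:Z + (if o then jump e else 0))].
Proof.
case: o => /=; rewrite !addr0 ![h + _ - _]addrAC //.
by rewrite perm_sym (perm_catC [:: _] [:: _]).
Qed.

Lemma rise_in_order o e e' :
  rise (if o then [:: e; e'] else [:: e'; e]) = jump e + jump e'.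
Proof. by case: o; rewrite rise_pair ?[jump e' + _]addrC. Qed.

(** The sides of the two new passages on a strand are opposite, so the low heights
agree on each strand: the two chords have the same index and opposite signs. *)
Lemma code_polynomial_Omega2 c d s l oe X Y :
    let p := Passage c s l in
    let q := Passage d (~~ s) l in
    let E := [:: p; q] ++ X ++ in_order oe (mate p) (mate q) ++ Y in
  well_paired E -> code_polynomial E = code_polynomial (X ++ Y).
Proof.
move=> p q E /gauss_diagram_wf; rewrite /code_polynomial.
case: l @p @q @E => [o|] p q E; last first.
  have -> // : gauss_diagram E = gauss_diagram (X ++ Y).
  by rewrite /E !gauss_diagram_cat; case: oe {E}.
pose e : endpoint := (c, o, o == s); pose e' : endpoint := (d, o, o == ~~ s).
have -> : gauss_diagram E = [:: e; e'] ++ gauss_diagram X ++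
    (if oe then [:: flip e; flip e'] else [:: flip e'; flip e]) ++ gauss_diagram Y.
  rewrite /E !gauss_diagram_cat /e /e' /p /q; congr (_ ++ _ ++ _ ++ _).
  by case: oe {E}; case: o @p @q @e @e'; case: s.
rewrite gauss_diagram_cat; set GX := gauss_diagram X; set GY := gauss_diagram Y.
have sE : endpoint_side e = s by rewrite /endpoint_side /e; case: (o) (s) => [] [].
have sE' : endpoint_side e' = ~~ s by rewrite /endpoint_side /e'; case: (o) (s) => [] [].
have jE : jump e' = - jump e by rewrite /jump sE sE'; case: (s).
rewrite !lows_cat rise_in_order rise_pair !jump_flip jE !addrN !addr0 !add0r.
set LX := lows 0 GX; set LY := lows (rise GX) GY; set S2 := (X in LX ++ X ++ LY).
set S1 := lows 0 _.
move=> wfG.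
have wfL : gauss_wf [seq z.1 | z <- S1 ++ LX ++ S2 ++ LY].
  by rewrite !map_cat !lows_endpoints.
have [x [y [H1 H2]]] : exists x y,
     perm_eq S1 [:: (e, x); (e', x)] /\ perm_eq S2 [:: (flip e, y); (flip e', y)].
  exists (- s%:Z), (rise GX - (~~ s)%:Z + (if oe then 0 else jump e)).
  split; first by rewrite /S1 /= sE sE' /jump sE; case: (s).
  apply: perm_trans (lows_in_order _ _ _ _) _.
  by rewrite !endpoint_side_flip !jump_flip jE opprK sE sE' negbK /jump sE; case: (oe) (s) => [] [] /=;
   rewrite ?addr0 ?subr0 ?addrK ?subrK.
have P : perm_eq (S1 ++ LX ++ S2 ++ LY)
    [:: (e, x), (flip e, y), (e', x), (flip e', y) & LX ++ LY].
  apply/permP => P; rewrite !count_cat (permP H1) (permP H2) /= !count_cat; lia.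
have [-> wfL'] := index_sum_remove wfL P.
have [-> _] := index_sum_remove wfL' (perm_refl _).
have -> : is_over e' = is_over e by [].
have -> : e'.2 = ~~ e.2 by rewrite /e /e' /=; case: (o) (s) => [] [].
by rewrite even_monomialN addrA addrN add0r.
Qed.

(** The sides prescribed by the triangle make the low heights of the two endpoints of
each chord move by the same amount when all three pairs are exchanged. *)
Lemma index_sum_triangle m (a b c : endpoint) o1 o2 o3 X Y Z :
    let tri o1 o2 o3 := (if o1 then [:: a; b] else [:: b; a]) ++ X
      ++ (if o2 then [:: flip a; c] else [:: c; flip a]) ++ Y
      ++ (if o3 then [:: flip b; flip c] else [:: flip c; flip b]) ++ Z in
    endpoint_side a = ((o1 == o2) == m) -> endpoint_side b = ((o1 == o3) == m) ->
    endpoint_side c = ((o2 == o3) == m) ->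
    gauss_wf (tri o1 o2 o3) ->
  index_sum (lows 0 (tri o1 o2 o3)) = index_sum (lows 0 (tri (~~ o1) (~~ o2) (~~ o3))).
Proof.
move=> tri sa sb sc wfG.
pose h2 := jump a + jump b + rise X; pose h3 := h2 + (jump (flip a) + jump c) + rise Y.
pose R := lows (jump a + jump b) X ++ lows (h2 + (jump (flip a) + jump c)) Y
   ++ lows (h3 + (jump (flip b) + jump (flip c))) Z.
have P p1 p2 p3 : perm_eq (lows 0 (tri p1 p2 p3))
   [:: (a, 0 - (endpoint_side a)%:Z + (if p1 then 0 else jump b)),
       (flip a, h2 - (endpoint_side (flip a))%:Z + (if p2 then 0 else jump c)),
       (b, 0 - (endpoint_side b)%:Z + (if p1 then jump a else 0)),
       (flip b, h3 - (endpoint_side (flip b))%:Z + (if p3 then 0 else jump (flip c))),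
       (c, h2 - (endpoint_side c)%:Z + (if p2 then jump (flip a) else 0)),
       (flip c, h3 - (endpoint_side (flip c))%:Z + (if p3 then jump (flip b) else 0)) & R].
  rewrite /tri !lows_cat !rise_in_order add0r -/h2 -/h3.
  apply/permP => Q; rewrite !count_cat !(permP (lows_in_order _ _ _ _)) /R /= !count_cat.
  move: (nat_of_bool (Q _)) (nat_of_bool (Q _)) (nat_of_bool (Q _)) (nat_of_bool (Q _))
    (nat_of_bool (Q _)) (nat_of_bool (Q _)) (count Q _) (count Q _) (count Q _).
  by lia.
have wfL p1 p2 p3 : gauss_wf [seq z.1 | z <- lows 0 (tri p1 p2 p3)].
  rewrite lows_endpoints; have [uG flG eqG] := wfG.
  have pr : perm_eq (tri p1 p2 p3) (tri o1 o2 o3).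
    have /(perm_map fst) := P p1 p2 p3; have /(perm_map fst) := P o1 o2 o3.
    rewrite /= !lows_endpoints => H1 H2.
    by apply: perm_trans H2 _; rewrite perm_sym.
  have mm := perm_mem pr.
  split; first by rewrite (perm_uniq pr).
    by move=> e; rewrite !mm; apply: flG.
  by move=> e e'; rewrite !mm; apply: eqG.
have [-> w1] := index_sum_remove (wfL _ _ _) (P o1 o2 o3).
have [-> w2] := index_sum_remove w1 (perm_refl _).
have [-> _] := index_sum_remove w2 (perm_refl _).
have [-> w1'] := index_sum_remove (wfL _ _ _) (P (~~ o1) (~~ o2) (~~ o3)).
have [-> w2'] := index_sum_remove w1' (perm_refl _).
have [-> _] := index_sum_remove w2' (perm_refl _).
rewrite !jump_flip !endpoint_side_flip /jump sa sb sc; clearbody R h3 h2.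
(* Only the difference of the two low heights counts, for either level. *)
have EM (e : endpoint) x y x' y' : y - x = y' - x' ->
    even_monomial e.2 (1 + (if is_over e then y - x else x - y))
    = even_monomial e.2 (1 + (if is_over e then y' - x' else x' - y')).
  by move=> E; rewrite -(opprB y x) -(opprB y' x') E.
congr (_ + _); last congr (_ + _); last congr (_ + _).
- by apply: EM; clear; case: o1 o2 o3 m => [] [] [] [] /=; ring.
- by apply: EM; clear; case: o1 o2 o3 m => [] [] [] [] /=; ring.
by apply: EM; clear; case: o1 o2 o3 m => [] [] [] [] /=; ring.
Qed.

Lemma code_polynomial_Omega3 m l12 l13 l23 a b c o1 o2 o3 X Y Z :
    third_move_levels l12 l13 l23 ->
    well_paired (triangle m l12 l13 l23 a b c o1 o2 o3 X Y Z) ->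
  code_polynomial (triangle m l12 l13 l23 a b c o1 o2 o3 X Y Z)
  = code_polynomial (triangle m l12 l13 l23 a b c (~~ o1) (~~ o2) (~~ o3) X Y Z).
Proof.
move=> lev /gauss_diagram_wf; rewrite /code_polynomial /triangle.
have negE (x y : bool) : (~~ x == ~~ y) = (x == y) by case: x y => [] [].
rewrite !negE; set sa := ((o1 == o2) == m); set sb := ((o1 == o3) == m).
set sc := ((o2 == o3) == m).
case: l12 l13 l23 lev => [h12|] [h13|] [h23|] // lev; rewrite !gauss_diagram_cat;
  last by case: (o1); case: (o2); case: (o3).
- pose ea : endpoint := (a, h12, h12 == sa); pose eb : endpoint := (b, h13, h13 == sb).
  pose ec : endpoint := (c, h23, h23 == sc).
  have E1 o : gauss_diagram (in_order o (Passage a sa (Some h12)) (Passage b sb (Some h13)))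
      = if o then [:: ea; eb] else [:: eb; ea] by case: o.
  have E2 o : gauss_diagram (in_order o (mate (Passage a sa (Some h12))) (Passage c sc (Some h23)))
      = if o then [:: flip ea; ec] else [:: ec; flip ea].
    by rewrite /ea /flip; case: o; case: (h12); case: (sa).
  have E3 o : gauss_diagram (in_order o (mate (Passage b sb (Some h13))) (mate (Passage c sc (Some h23))))
      = if o then [:: flip eb; flip ec] else [:: flip ec; flip eb].
    by rewrite /eb /ec /flip; case: o; case: (h13); case: (sb); case: (h23); case: (sc).
  rewrite !E1 !E2 !E3; apply: (index_sum_triangle (m := m)).
  + by rewrite /ea /endpoint_side /is_over /= -/sa; case: (h12) (sa) => [] [].
  + by rewrite /eb /endpoint_side /is_over /= -/sb; case: (h13) (sb) => [] [].
  by rewrite /ec /endpoint_side /is_over /= -/sc; case: (h23) (sc) => [] [].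
all: by case: (o1); case: (o2); case: (o3).
Qed.

Lemma move_polynomial D E :
  move D E -> well_paired D -> well_paired E -> code_polynomial D = code_polynomial E.
Proof.
case=> {D E} [k D wD _ | h D hI _ _ | c s l X _ wE | c d s l oe X Y p q _ wE
  | m l12 l13 l23 a b c o1 o2 o3 X Y Z lev wD _].
- by rewrite code_polynomial_rot.
- by rewrite code_polynomial_rename.
- by rewrite code_polynomial_Omega1.
- by rewrite code_polynomial_Omega2.
exact: code_polynomial_Omega3.
Qed.

Lemma equivalent_polynomial (D E : diagram) :
  equivalent D E -> diagram_polynomial D = diagram_polynomial E.
Proof.
elim=> {D E} [D E mv | D | D E _ -> | D E F _ -> _ ->] //.
have /andP[wD _] := valP D; have /andP[wE _] := valP E.
by rewrite !diagram_polynomialE (move_polynomial mv).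
Qed.

(** Invariance makes the choice of the representative harmless. *)
Lemma odd_writhe_polynomial_pi (D : diagram) :
  odd_writhe_polynomial (\pi_virtual_knot%qT D) = diagram_polynomial D.
Proof.
apply: equivalent_polynomial; apply/asboolP.
have /eqmodP : (repr (\pi_virtual_knot%qT D) = D %[mod virtual_knot])%qT by rewrite reprK.
by [].
Qed.

(** * Counting the faces of a code *)

Fixpoint before (e : passage) (s : seq passage) (v : passage) : passage :=
  if s is x :: s' then if x == v then e else before x s' v else e.

Definition previous (D : seq passage) (v : passage) : passage :=
  before (last v D) D v.

(** At the crossing of [v] (with [side v]) and [mate v] there are four corners; each
one identifies the dart that arrives in it with the dart that leaves it.  A dart
is named by the passage that its edge leaves, and by its direction. *)
Definition corners_at (D : seq passage) (v : passage) :
    seq ((passage * bool) * (passage * bool)) :=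
  [:: ((previous D v, true), (mate v, true));
      ((previous D (mate v), true), (previous D v, false));
      ((v, false), (previous D (mate v), false));
      ((mate v, false), (v, true))].

Definition corner (D : seq passage) (x y : passage * bool) : Prop :=
  exists v, [/\ v \in D, side v & (x, y) \in corners_at D v].

Definition same_face (D : seq passage) : passage * bool -> passage * bool -> Prop :=
  clos_refl_sym_trans _ (corner D).

(** A labelling of the darts by faces.  It refers to names of passages and not to
positions, so that most darts keep their names when a code is extended. *)
Definition has_faces (D : seq passage) (k : nat) : Prop :=
  exists lab : passage * bool -> nat,
    [/\ forall p b, p \in D -> (lab (p, b) < k)%N,
        forall j, (j < k)%N -> exists p b, p \in D /\ lab (p, b) = j,
        forall x y, corner D x y -> lab x = lab y
      & forall p b p' b', p \in D -> p' \in D -> lab (p, b) = lab (p', b') ->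
          same_face D (p, b) (p', b')].

Lemma before_cat e s1 s2 v :
  before e (s1 ++ s2) v =
  if v \in s1 then before e s1 v else before (last e s1) s2 v.
Proof.
elim: s1 e => [|x s1 IH] e //=; rewrite inE eq_sym.
by case: eqP => //= _; apply: IH.
Qed.

Lemma before_index e s v : before e s v = nth e (e :: s) (index v s).
Proof.
elim: s e => [|x s IH] e //=; case: eqP => //= _; rewrite IH /=.
by apply: set_nth_default; rewrite /= ltnS index_size.
Qed.

(** For all [v] but the head, the predecessor does not see what precedes the list. *)
Lemma before_cases s v : v \in s ->
  (forall e, before e s v = e) \/ (exists2 u, u \in s & forall e, before e s v = u).
Proof.
case: s => [|x s] //=; rewrite inE eq_sym; case: eqP => [_ _ | _ /= vs]; first by left.
right; exists (before x s v) => //.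
rewrite before_index; case: (index v s) (index_mem v s) => [|i] /=; rewrite vs => lt.
  by rewrite mem_head.
by rewrite inE mem_nth ?orbT // ltnW.
Qed.

Lemma mem_previous D v : v \in D -> previous D v \in D.
Proof.
rewrite /previous => vD; have [->|[u uD ->//]] := before_cases vD.
by case: D vD => [|x D] //= _; apply: mem_last.
Qed.

Lemma previous_ord_pred D (i : 'I_(size D)) : uniq D ->
  tnth (in_tuple D) (ord_pred i) = previous D (tnth (in_tuple D) i).
Proof.
move=> uD; set v := tnth _ i; rewrite /previous before_index.
have vE : v = nth v D i by rewrite {1}/v (tnth_nth v).
rewrite (tnth_nth v) /= vE index_uniq // -vE.
have := ltn_ord i; case: (nat_of_ord i) => [|j] ltj /=.
  by rewrite modn_small ?prednK // -nth_last.
rewrite modnDr modn_small; last exact: ltnW.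
by apply: set_nth_default; exact: ltnW.
Qed.

Section FaceCount.

Variables (D : seq passage) (k : nat).
Hypothesis wD : well_paired D.

Let uD : uniq D := well_paired_uniq wD.
Let named (x : dart D) : passage * bool := (tnth (in_tuple D) x.1, x.2).

Lemma mate_mem p : p \in D -> mate p \in D.
Proof. by case/well_pairedP: wD => _ + _; apply. Qed.

Lemma named_inj : injective named.
Proof.
move=> [i b] [j b'] [] /eqP; set v := tnth _ i => + ->.
rewrite /v !(tnth_nth v) /= nth_uniq //.
by move=> /eqP/val_inj ->.
Qed.

Lemma named_onto p b : p \in D -> {i | named (i, b) = (p, b)}.
Proof.
move=> pD; have lt : (index p D < size D)%N by rewrite index_mem.
by exists (Ordinal lt); rewrite /named (tnth_nth p) /= nth_index.
Qed.

Lemma tnth_partner (j : 'I_(size D)) p : p \in D ->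
  tnth (in_tuple D) (insubd j (index p D)) = p.
Proof.
by move=> pD; rewrite (tnth_nth p) val_insubd index_mem pD nth_index.
Qed.

Lemma named_face_next (j : 'I_(size D)) b :
  let p := tnth (in_tuple D) j in
  named (face_next (if b then ord_pred j else j, b))
  = if b == side p then (mate p, true) else (previous D (mate p), false).
Proof.
move=> p; have mD : mate p \in D by apply/mate_mem/mem_tnth.
rewrite /face_next /=.
have -> : (if b then ordS (if b then ord_pred j else j)
           else (if b then ord_pred j else j)) = j by case: (b); rewrite ?ord_predK.
rewrite -/p; case: (b == side p); rewrite /named /= ?previous_ord_pred //.
  by rewrite tnth_partner.
by rewrite tnth_partner.
Qed.

Lemma face_next_inj : injective (@face_next D).
Proof.
have shift (x : dart D) : exists j, x = (if x.2 then ord_pred j else j, x.2).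
  by case: x => i [] /=; [exists (ordS i); rewrite ordSK | exists i].
have prevI : {in D &, injective (previous D)}.
  move=> p q pD qD; have [i [<-]] := named_onto true pD; have [j [<-]] := named_onto true qD.
  rewrite -!previous_ord_pred // => e.
  have : named (ord_pred i, true) = named (ord_pred j, true) by rewrite /named /= e.
  by move/named_inj/(congr1 fst)/(can_inj (@ord_predK _)) ->.
move=> x y; have [i ->] := shift x; have [j ->] := shift y.
move/(congr1 named); rewrite !named_face_next.
set p := tnth _ i; set q := tnth _ j.
have pD : mate p \in D by apply/mate_mem/mem_tnth.
have qD : mate q \in D by apply/mate_mem/mem_tnth.
move=> E; have pq : p = q.
  apply: (can_inj mateK); move: E.
  by case: ifP => _; case: ifP => _ // /(congr1 fst) /= // /prevI ->.
have ij : i = j.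
  have : named (i, true) = named (j, true) by rewrite /named /= -/p -/q pq.
  by move/named_inj/(congr1 fst).
rewrite ij; move: E; rewrite pq.
by case: (x.2); case: (y.2); case: (side q).
Qed.

(** The corners are the graph of [face_next], written without positions. *)
Lemma corner_face_next x : corner D (named x) (named (face_next x)).
Proof.
have [j ->] : exists j, x = (if x.2 then ord_pred j else j, x.2).
  by case: x => i [] /=; [exists (ordS i); rewrite ordSK | exists i].
rewrite named_face_next; set p := tnth _ j; have pD : p \in D by apply: mem_tnth.
have -> : named (if x.2 then ord_pred j else j, x.2) = (if x.2 then previous D p else p, x.2).
  by rewrite /named /p; case: (x.2) => //=; rewrite -previous_ord_pred.
case sp: (side p); last first.
- exists (mate p); split; [exact: mate_mem | by rewrite /mate /side /= -/(side p) sp | ].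
  by case: (x.2); rewrite /corners_at /= mateK !inE eqxx ?orbT.
by exists p; split=> //; case: (x.2); rewrite /corners_at /= !inE eqxx ?orbT.
Qed.

Lemma corner_connect a b : corner D a b ->
  exists2 x, named x = a & named (face_next x) = b.
Proof.
have key p c : p \in D -> exists2 x, named x = (if c then previous D p else p, c) &
    named (face_next x) = if c == side p then (mate p, true) else (previous D (mate p), false).
  move=> pD; have [j [jp]] := named_onto true pD.
  exists (if c then ord_pred j else j, c); last by rewrite named_face_next jp.
  by rewrite /named -jp; case: (c) => //=; rewrite previous_ord_pred.
case=> v [vD sv]; have mD := mate_mem vD.
have sm : side (mate v) = false by rewrite /mate /side /= -/(side v) sv.
rewrite !inE => /or4P[] /eqP[-> ->].
- by have := key v true vD; rewrite sv.
- by have := key (mate v) true mD; rewrite sm mateK.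
- by have := key v false vD; rewrite sv.
by have := key (mate v) false mD; rewrite sm mateK.
Qed.

Lemma same_face_connect a b x y : same_face D a b -> named x = a -> named y = b ->
  fconnect (@face_next D) x y.
Proof.
have inD a' b' : same_face D a' b' -> (a'.1 \in D) = (b'.1 \in D).
  elim=> {a' b'} [a' b' /corner_connect[z <- <-] | // | a' b' _ -> | a' b' c _ -> _ ->] //.
  by rewrite !mem_tnth.
move=> ab; elim: ab x y => {a b} [a b /corner_connect[z <- <-] | a | a b _ IH | a b c ab IH _ IH'] x y.
- by move=> /named_inj -> /named_inj ->; apply: fconnect1.
- by move=> <- /named_inj ->; apply: connect0.
- by move=> xb ya; rewrite fconnect_sym; [apply: IH | apply: face_next_inj].
move=> xa yc; have bD : b.1 \in D by rewrite -(inD _ _ ab) -xa mem_tnth.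
have [i ib] := named_onto b.2 bD.
by apply: connect_trans (IH x (i, b.2) xa _) (IH' _ y _ yc); rewrite ib; case: (b).
Qed.

(** The labels are in bijection with the orbits of [face_next]. *)
Lemma fcard_face_next : has_faces D k -> fcard (@face_next D) predT = k.
Proof.
case=> lab [ltk onto sound complete].
have labF x : lab (named (face_next x)) = lab (named x).
  by apply/esym/sound/corner_face_next.
have symF := fconnect_sym face_next_inj.
have labC x y : fconnect (@face_next D) x y -> lab (named x) = lab (named y).
  by move=> /iter_findex <-; elim: (findex _ x y) => [|n IH] //; rewrite iterS labF.
have rep (j : 'I_k) : {x | lab (named x) = j}.
  apply/cid; have [p [b [pD <-]]] := onto j (ltn_ord j).
  by have [i <-] := named_onto b pD; exists (i, b).
pose r j := froot (@face_next D) (sval (rep j)).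
have rI : injective r.
  move=> i j /eqP; rewrite /r (root_connect symF) => /labC.
  by rewrite (svalP (rep i)) (svalP (rep j)) => /val_inj.
rewrite -[RHS](card_ord k) -(card_image rI) /n_comp_mem; apply: eq_card => x.
rewrite !inE andbT; apply/idP/imageP => [/eqP rx | [j _ ->]]; last exact: roots_root.
have lx : (lab (named x) < k)%N by apply: ltk; apply: mem_tnth.
exists (Ordinal lx) => //; apply: etrans (esym rx) _; apply/eqP.
rewrite (root_connect symF).
apply: same_face_connect erefl erefl.
by apply: complete; rewrite ?mem_tnth // (svalP (rep (Ordinal lx))).
Qed.

Lemma has_faces_planar : has_faces D k -> ((size D)./2 + k = size D + 2)%N -> planar D.
Proof. by move=> /fcard_face_next <- E; rewrite /planar E eqxx orbT. Qed.

End FaceCount.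

(** A map of codes that is a retraction on darts: [r] sends each dart of [D'] to a
dart of [D] on the same face or to one of [m] new faces, and [s] is a section
of it. *)
Lemma has_faces_extend D D' k m (r : passage * bool -> (passage * bool) + nat)
    (s : (passage * bool) + nat -> passage * bool) :
    (forall p b, p \in D ->
      (s (inl (p, b))).1 \in D' /\ r (s (inl (p, b))) = inl (p, b)) ->
    (forall j, (j < m)%N -> (s (inr j)).1 \in D' /\ r (s (inr j)) = inr j) ->
    (forall p b, p \in D' ->
      match r (p, b) with inl x => x.1 \in D | inr j => (j < m)%N end) ->
    (forall p b, p \in D' -> same_face D' (p, b) (s (r (p, b)))) ->
    (forall x y, corner D' x y ->
      match r x, r y with
      | inl a, inl b => same_face D a b
      | inr i, inr j => i = j
      | _, _ => False
      end) ->
    (forall a b, corner D a b ->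
      exists x y, [/\ x.1 \in D', y.1 \in D', corner D' x y, r x = inl a & r y = inl b]) ->
  has_faces D k -> has_faces D' (k + m).
Proof.
move=> s_old s_new r_dom r_conn r_corner lift [lab [ltk onto sound complete]].
pose lab' z := match r z with inl x => lab x | inr j => (k + j)%N end.
have sound' a b : same_face D a b -> lab a = lab b.
  by elim=> {a b} [a b /sound | | a b _ -> | a b c _ -> _ ->].
exists lab'; split.
- move=> p b /(r_dom _ b); rewrite /lab'; case: (r _) => [[q c] /= qD | j jm].
    by apply: ltn_addr; apply: ltk.
  by rewrite ltn_add2l.
- move=> j; case: (ltnP j k) => [/onto[p [b [pD lj]]] _ | kj jkm].
    have [sD rs] := s_old p b pD.
    by exists (s (inl (p, b))).1, (s (inl (p, b))).2; rewrite -surjective_pairing /lab' rs.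
  have jm : (j - k < m)%N by lia.
  have [sD rs] := s_new _ jm.
  exists (s (inr (j - k)%N)).1, (s (inr (j - k)%N)).2; split=> //.
  by rewrite -surjective_pairing /lab' rs; lia.
- move=> x y /r_corner; rewrite /lab'; case: (r x) => [a|i]; case: (r y) => [b|j] //.
    exact: sound'.
  by move=> ->.
have lift' a b : same_face D a b -> a.1 \in D -> b.1 \in D -> 
    same_face D' (s (inl a)) (s (inl b)).
  move=> ab _ _; elim: ab => {a b} [a b /lift | a | a b _ | a b c _ + _].
  - case=> [[p c] [[q d] [pD qD xy rx ry]]]; rewrite -rx -ry.
    apply: rst_trans (rst_sym _ _ _ _ (r_conn _ _ pD)) _.
    by apply: rst_trans (r_conn _ _ qD); apply: rst_step.
  - exact: rst_refl.
  - exact: rst_sym.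
  exact: rst_trans.
move=> p b p' b' pD pD' E.
apply: rst_trans (r_conn p b pD) _; apply: rst_sym.
apply: rst_trans (r_conn p' b' pD') _; apply: rst_sym.
have := r_dom p b pD; have := r_dom p' b' pD'; move: E; rewrite /lab'.
case: (r (p, b)) => [[q c]|i]; case: (r (p', b')) => [[q' c']|j] /= E qD' qD.
- by apply: lift' => //; apply: complete.
- by move: (ltk q c qD); rewrite E ltnNge leq_addr.
- by move: (ltk q' c' qD'); rewrite -E ltnNge leq_addr.
by have -> : i = j by [lia]; apply: rst_refl.
Qed.

(** * Inserting a trefoil and tripling a crossing *)

(** At an old crossing, the new corners retract to the old ones, so that only the new
crossings and the one they are attached to remain to be examined. *)
Lemma corners_transport D D' (r : passage * bool -> (passage * bool) + nat) v :
    (forall b, r (v, b) = inl (v, b)) ->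
    (forall b, r (mate v, b) = inl (mate v, b)) ->
    (forall b, r (previous D' v, b) = inl (previous D v, b)) ->
    (forall b, r (previous D' (mate v), b) = inl (previous D (mate v), b)) ->
  [seq (r x.1, r x.2) | x <- corners_at D' v]
  = [seq (inl x.1, inl x.2) | x <- corners_at D v].
Proof. by move=> rv rm rp rpm; rewrite /= !rv !rm !rp !rpm. Qed.

Lemma corner_transported D D' (r : passage * bool -> (passage * bool) + nat) v x y :
    v \in D -> side v ->
    [seq (r x.1, r x.2) | x <- corners_at D' v]
    = [seq (inl x.1, inl x.2) | x <- corners_at D v] ->
    (x, y) \in corners_at D' v ->
  match r x, r y with
  | inl a, inl b => same_face D a b
  | inr i, inr j => i = j
  | _, _ => False
  end.
Proof.
move=> vD sv transp xy; have := map_f (fun x => (r x.1, r x.2)) xy.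
rewrite transp => /mapP[[a b] ab [-> ->]] /=.
by apply: rst_step; exists v.
Qed.

Lemma corner_lifted D D' (r : passage * bool -> (passage * bool) + nat) v a b :
    v \in D' -> mate v \in D' -> side v ->
    [seq (r x.1, r x.2) | x <- corners_at D' v]
    = [seq (inl x.1, inl x.2) | x <- corners_at D v] ->
    (a, b) \in corners_at D v ->
  exists x y,
    [/\ x.1 \in D', y.1 \in D', corner D' x y, r x = inl a & r y = inl b].
Proof.
move=> vD' mvD' sv transp ab.
have := map_f (fun x => (inl x.1 : _ + nat, inl x.2 : _ + nat)) ab.
rewrite -transp => /mapP[[x y] xy [ra rb]].
have inD' : {subset [:: previous D' v; previous D' (mate v); v; mate v] <= D'}.
  by apply/allP; rewrite [all _ _]/= vD' mvD' !mem_previous.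
exists x, y; split=> //; last by exists v.
- by move: xy; rewrite !inE => /or4P[] /eqP[-> _]; apply: inD'; rewrite !inE eqxx ?orbT.
by move: xy; rewrite !inE => /or4P[] /eqP[_ ->]; apply: inD'; rewrite !inE eqxx ?orbT.
Qed.

Lemma passage_eqE a s l b t m :
  (Passage a s l == Passage b t m) = [&& a == b, s == t & l == m].
Proof. by rewrite /Passage !xpair_eqE andbA. Qed.

Lemma corner_nth D v i : v \in D -> side v -> (i < 4)%N ->
  let x := nth ((v, true), (v, true)) (corners_at D v) i in corner D x.1 x.2.
Proof.
move=> vD sv i4 x; exists v; split=> //.
by rewrite -surjective_pairing mem_nth.
Qed.

Lemma same_face_corner D v i : v \in D -> side v -> (i < 4)%N ->
  let x := nth ((v, true), (v, true)) (corners_at D v) i in same_face D x.1 x.2.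
Proof. by move=> vD sv i4; apply/rst_step/corner_nth. Qed.

(** Connected sum with the standard trefoil at the base edge.  The trefoil has five
faces; two merge with those on the two sides of the edge that enters [D], and the
three others are new.  The retraction [r] is read off from the twelve corners of
the new crossings. *)
Lemma has_faces_trefoil D k v1 v2 v3 l1 l2 l3 :
    let p1 := Passage v1 true l1 in let p2 := Passage v2 false l2 in
    let p3 := Passage v3 true l3 in
    well_paired D -> D != [::] -> uniq [:: v1; v2; v3] ->
    (forall p, p \in D -> vertex p \notin [:: v1; v2; v3]) ->
  has_faces D k ->
  has_faces ([:: p1; p2; p3; mate p1; mate p2; mate p3] ++ D) (k + 3).
Proof.
move=> p1 p2 p3 wD; case: D wD => // x0 D0; set D := x0 :: D0 => wD _ uv fresh.
set D' := _ ++ D; set z := last x0 D0.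
have zD : z \in D by apply: mem_last.
have mD p : p \in D -> mate p \in D by apply: mate_mem.
have [n12 n13 n23] : [/\ (v1 == v2) = false, (v1 == v3) = false & (v2 == v3) = false].
  by move: uv; rewrite /= !inE !negb_or => /and3P[/andP[/negbTE-> /negbTE->] /negbTE-> _].
have [n21 n31 n32] : [/\ (v2 == v1) = false, (v3 == v1) = false & (v3 == v2) = false].
  by rewrite !(eq_sym v3) eq_sym n12 n13 n23.
(* New faces: 0 is a triangle, 1 and 2 are bigons. *)
pose r (x : passage * bool) : (passage * bool) + nat :=
  let: (p, b) := x in
  if vertex p == v1 then
    if side p then inr (b : nat) else if b then inl (z, true) else inr 1%N
  else if vertex p == v2 then
    if side p then inr (if b then 2%N else 0%N) else if b then inl (z, true) else inr 2%N
  else if vertex p == v3 then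
    if side p then if b then inl (z, false) else inr 0%N else inl (z, b)
  else inl (p, b).
pose s (y : (passage * bool) + nat) :=
  match y with inl x => x | inr 2%N => (p2, false) | inr j => (p1, j == 1%N) end.
have r1 b : r (p1, b) = inr (b : nat) by rewrite /r /= eqxx.
have r1' b : r (mate p1, b) = if b then inl (z, true) else inr 1%N by rewrite /r /= eqxx.
have r2 b : r (p2, b) = if b then inl (z, true) else inr 2%N by rewrite /r /= n21 eqxx.
have r2' b : r (mate p2, b) = inr (if b then 2%N else 0%N) by rewrite /r /= n21 eqxx.
have r3 b : r (p3, b) = if b then inl (z, false) else inr 0%N.
  by rewrite /r /= n31 n32 eqxx.
have r3' b : r (mate p3, b) = inl (z, b) by rewrite /r /= n31 n32 eqxx.
have rD p b : p \in D -> r (p, b) = inl (p, b).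
  by move=> /fresh; rewrite /r !inE !negb_or => /and3P[/negbTE-> /negbTE-> /negbTE->].
have notin6 p : p \in D -> (p \in [:: p1; p2; p3; mate p1; mate p2; mate p3]) = false.
  move=> /fresh fp; apply/negbTE; apply: contra fp.
  by rewrite !inE; do !case/predU1P=> [->|]; last move=> /eqP ->; rewrite /= eqxx ?orbT.
have [P1 P2 P3] : [/\ previous D' p1 = z, previous D' p2 = p1 & previous D' p3 = p2].
  by rewrite /previous /= !passage_eqE /= eqxx ?n12 ?n13 ?n23 ?eqxx.
have [P1' P2' P3'] : [/\ previous D' (mate p1) = p3, previous D' (mate p2) = mate p1
    & previous D' (mate p3) = mate p2].
  by rewrite /previous /= !passage_eqE /= ?n12 ?n13 ?n23 ?n21 ?n31 ?n32 ?andbF ?eqxx.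
have rP v b : v \in D -> r (previous D' v, b) = inl (previous D v, b).
  move=> vD; rewrite /previous /D' before_cat notin6 //.
  have [E|[u uD E]] := before_cases vD; rewrite !E; first by rewrite r3'.
  by rewrite rD.
have sub6 p : p \in [:: p1; p2; p3; mate p1; mate p2; mate p3] -> p \in D'.
  by rewrite mem_cat => ->.
have subD p : p \in D -> p \in D' by rewrite mem_cat => ->; rewrite orbT.
have transp v (vD : v \in D) := corners_transport (fun b => rD v b vD)
  (fun b => rD _ b (mD _ vD)) (fun b => rP v b vD) (fun b => rP _ b (mD _ vD)).
have [m1 m2' m3] : [/\ p1 \in D', mate p2 \in D' & p3 \in D'].
  by split; apply: sub6; rewrite !inE eqxx ?orbT.
have C1 i := @same_face_corner D' p1 i m1 isT.
have C2 i := @same_face_corner D' (mate p2) i m2' isT.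
have C3 i := @same_face_corner D' p3 i m3 isT.
have sP : same_face D' (z, true) (mate p1, true) by have := C1 0%N isT; rewrite /= P1.
have sQ : same_face D' (p3, true) (z, false) by have := C1 1%N isT; rewrite /= P1 P1'.
have s13 : same_face D' (p1, false) (p3, false) by have := C1 2%N isT; rewrite /= P1'.
have s11 : same_face D' (mate p1, false) (p1, true) by have := C1 3%N isT.
have s12 : same_face D' (mate p1, true) (p2, true).
  by have := C2 0%N isT; rewrite /= P2' mateK.
have s21 : same_face D' (mate p2, false) (p1, false).
  by have := C2 2%N isT; rewrite /= mateK P2.
have s22 : same_face D' (p2, false) (mate p2, true) by have := C2 3%N isT; rewrite /= mateK.
have s23 : same_face D' (p2, true) (mate p3, true) by have := C3 0%N isT; rewrite /= P3.
have s33 : same_face D' (mate p3, false) (p3, true) by have := C3 3%N isT.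
clearbody r; apply: (@has_faces_extend D D' k 3 r s).
- by move=> p b pD; rewrite /= rD // subD.
- by move=> [|[|[|j]]] // _; rewrite /= ?r1 ?r2; split=> //; apply: sub6; rewrite !inE eqxx ?orbT.
- move=> p b; rewrite mem_cat => /orP[|pD]; last by rewrite rD.
  rewrite !inE; do !case/predU1P=> [->|]; last move=> /eqP ->;
    by case: b; rewrite ?(r1, r2, r3, r1', r2', r3').
- move=> p b; rewrite mem_cat => /orP[|pD]; last by rewrite rD //; apply: rst_refl.
  rewrite !inE; do !case/predU1P=> [->|]; last move=> /eqP ->.
  + by case: b; rewrite r1; apply: rst_refl.
  + case: b; rewrite r2 /=; last exact: rst_refl.
    by apply: rst_sym; apply: rst_trans sP s12.
  + by case: b; rewrite r3 //=; apply: rst_sym.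
  + by case: b; rewrite r1' //=; apply: rst_sym.
  + by case: b; rewrite r2' //=; apply: rst_sym.
  case: b; rewrite r3' /=; last exact: rst_trans s33 sQ.
  by apply: rst_sym; apply: rst_trans sP (rst_trans _ _ _ _ _ s12 s23).
- move=> x y [v [vD' sv xy]]; move: vD'; rewrite mem_cat => /orP[|vD]; last first.
    exact: corner_transported vD sv (transp v vD) xy.
  rewrite !inE; do !case/predU1P=> [vE|]; last move=> /eqP vE;
    move: sv xy; rewrite vE // => _; rewrite !inE ?mateK.
  + rewrite P1 P1' => /or4P[] /eqP[-> ->]; rewrite ?(rD z _ zD) ?r1 ?r1' ?r3 //=; exact: rst_refl.
  + rewrite P3 P3' => /or4P[] /eqP[-> ->]; rewrite ?r2 ?r2' ?r3 ?r3' //=; exact: rst_refl.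
  rewrite P2 P2' => /or4P[] /eqP[-> ->]; rewrite ?r1 ?r1' ?r2 ?r2' //=; exact: rst_refl.
move=> a b [v [vD sv ab]].
exact: corner_lifted (subD v vD) (subD _ (mD _ vD)) sv (transp v vD) ab.
Qed.

(** Twisting the crossing [c] twice more, with the two strands antiparallel in the
twist region, creates two bigons.  The strand leaving [mate c] now leaves
[mate p], so the darts of [mate c] are renamed to those of [mate p]. *)
Lemma has_faces_triple D k vp vq vc lp lq lc X Y :
    let p := Passage vp true lp in let q := Passage vq false lq in
    let c := Passage vc true lc in
    D = [:: c] ++ X ++ [:: mate c] ++ Y -> well_paired D -> vp != vq ->
    (forall v, v \in D -> vertex v \notin [:: vp; vq]) ->
  has_faces D k ->
  has_faces ([:: p; q; c] ++ X ++ [:: mate c; mate q; mate p] ++ Y) (k + 2).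
Proof.
move=> p q c DE wD npq fresh; set D' := _ ++ X ++ _.
have [uD mD eD] := well_pairedP _ wD.
set y := last (mate c) Y.
have [cD c'D] : c \in D /\ mate c \in D.
  by rewrite DE !mem_cat !inE !eqxx !orbT.
have [cp cq] : (vc == vp) = false /\ (vc == vq) = false.
  by have := fresh c cD; rewrite !inE negb_or => /andP[/negbTE-> /negbTE->].
have [pc qc qp pq] : [/\ (vp == vc) = false, (vq == vc) = false, (vq == vp) = false
    & (vp == vq) = false].
  by rewrite !(eq_sym _ vc) (eq_sym vq) cp cq (negbTE npq).
pose O := X ++ Y.
have [cO c'O] : c \notin O /\ mate c \notin O.
  have P : perm_eq D [:: c, mate c & O].
    by apply/permP => P; rewrite DE /O /= !count_cat /=; lia.
  by move: uD; rewrite (perm_uniq P) /= inE negb_or => /and3P[/andP[_ ->] ->].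
have OD v : v \in O -> v \in D.
  by rewrite DE !mem_cat => /orP[] ->; rewrite !orbT.
have OD' v : v \in O -> v \in D'.
  by rewrite !mem_cat => /orP[] ->; rewrite !orbT.
have DO v : v \in D -> [\/ v = c, v = mate c | v \in O].
  rewrite DE !mem_cat !inE => /or4P[/eqP | vX | /eqP | vY];
    by [apply: Or31 | apply: Or32 | apply: Or33; rewrite ?vX ?vY ?orbT].
have vO v : v \in O -> (vertex v == vc) = false.
  move=> vO; apply/eqP => vv; move: cO c'O.
  by have [<-|<-] := eD c v cD (OD v vO) (esym vv); rewrite vO.
have mO v : v \in O -> mate v \in O.
  move=> vO'; have [mc|mc|//] := DO _ (mD _ (OD v vO')).
    by have := vO v vO'; rewrite -(mateK v) mc /= eqxx.
  by have := vO v vO'; rewrite -(mateK v) mc /= eqxx.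
(* New faces: the bigons 0, between [p] and [q], and 1, between [q] and [c]. *)
pose r (x : passage * bool) : (passage * bool) + nat :=
  let: (u, b) := x in
  if vertex u == vp then
    if side u then if b then inl (c, true) else inr 0%N else inl (mate c, b)
  else if vertex u == vq then
    if side u then if b then inl (y, false) else inr 0%N
    else if b then inr 1%N else inl (y, false)
  else if vertex u == vc then
    if side u then inl (c, b) else if b then inr 1%N else inl (c, true)
  else inl (u, b).
pose s (z : (passage * bool) + nat) :=
  match z with
  | inl (u, b) => (if u == mate c then mate p else u, b)
  | inr 0%N => (p, false)
  | inr _ => (q, true)
  end.
have rp b : r (p, b) = if b then inl (c, true) else inr 0%N by rewrite /r /= eqxx.
have rp' b : r (mate p, b) = inl (mate c, b) by rewrite /r /= eqxx.
have rq b : r (q, b) = if b then inr 1%N else inl (y, false).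
  by rewrite /r /= qp eqxx.
have rq' b : r (mate q, b) = if b then inl (y, false) else inr 0%N.
  by rewrite /r /= qp eqxx.
have rc b : r (c, b) = inl (c, b) by rewrite /r /= cp cq eqxx.
have rc' b : r (mate c, b) = if b then inr 1%N else inl (c, true).
  by rewrite /r /= cp cq eqxx.
have rO v b : v \in O -> r (v, b) = inl (v, b).
  move=> vO'; have := fresh v (OD v vO').
  by rewrite /r !inE negb_or (vO v vO') => /andP[/negbTE-> /negbTE->].
clearbody r.
have neO v : v \in O -> [/\ (p == v) = false, (q == v) = false, (c == v) = false,
    (mate c == v) = false & (mate q == v) = false].
  move=> vO'; have := fresh v (OD v vO'); rewrite !inE negb_or => /andP[fp fq].
  by split; apply/negbTE; apply/eqP => E; move: fp fq (vO v vO'); rewrite -E /= eqxx.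
have [Pp Pq Pc] : [/\ previous D' p = last (mate p) Y, previous D' q = p & previous D' c = q].
  rewrite /previous /= !passage_eqE /= !eqxx ?pq ?pc ?qc /=.
  by rewrite last_cat.
have [Pp' Pq' Pc'] : [/\ previous D' (mate p) = mate q, previous D' (mate q) = mate c
    & previous D' (mate c) = last c X].
  have nX v : vertex v \in [:: vp; vq; vc] -> v \in X = false.
    move=> vv; apply/negP => vX; have vO' : v \in O by rewrite mem_cat vX.
    have := fresh v (OD v vO'); have := vO v vO'; move: vv.
    by rewrite !inE => /or3P[] ->; rewrite ?orbT.
  rewrite /previous /= !before_cat !nX ?inE ?eqxx ?orbT //.
  by rewrite /= !passage_eqE /= ?eqxx ?(pq, qp, pc, cp, qc, cq) ?andbF /=.
have [Qc Qc'] : previous D c = y /\ previous D (mate c) = last c X.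
  have nX : mate c \in X = false.
    by apply/negbTE; apply: contra c'O; rewrite mem_cat => ->.
  rewrite /previous DE /= !before_cat nX /= eqxx !passage_eqE /= !eqxx /= ?andbF.
  by rewrite last_cat.
have rlast b : r (last (mate p) Y, b) = inl (y, b).
  rewrite /y; case E: Y => [|z Y1] /=; first exact: rp'.
  by rewrite rO // mem_cat E mem_last orbT.
have rlastX b : r (last c X, b) = inl (last c X, b).
  case E: X => [|z X1] /=; first exact: rc.
  by rewrite rO // mem_cat E mem_last.
have rP v b : v \in O -> r (previous D' v, b) = inl (previous D v, b).
  move=> vO'; have [np nq nc nc' nq'] := neO v vO'.
  have np' : (mate p == v) = false.
    have := fresh v (OD v vO'); rewrite !inE negb_or => /andP[fp _].
    by apply/eqP => E; move: fp; rewrite -E /= eqxx.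
  rewrite /previous DE /= np nq nc !before_cat.
  case: ifP => vX.
    have [E|[u uX E]] := before_cases vX; rewrite !E; first by rewrite rc.
    by rewrite rO // mem_cat uX.
  rewrite /= nc' nq' np'.
  have vY : v \in Y by move: vO'; rewrite mem_cat vX.
  have [E|[u uY E]] := before_cases vY; rewrite !E; first by rewrite rp'.
  by rewrite rO // mem_cat uY orbT.
have transp v (vO' : v \in O) := corners_transport (fun b => rO v b vO')
  (fun b => rO _ b (mO _ vO')) (fun b => rP v b vO') (fun b => rP _ b (mO _ vO')).
have [pD' q'D' cD'] : [/\ p \in D', mate q \in D' & c \in D'].
  by split; rewrite !mem_cat !inE ?eqxx ?orbT.
have p'D' : mate p \in D' by rewrite !mem_cat !inE ?eqxx ?orbT.
have qD' : q \in D' by rewrite !mem_cat !inE ?eqxx ?orbT.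
have D'O v : v \in D' -> [\/ v \in [:: p; q; c], v \in [:: mate c; mate q; mate p] | v \in O].
  rewrite !mem_cat => /or4P[vv | vX | vv | vY];
    by [apply: Or31 | apply: Or32 | apply: Or33; rewrite ?vX ?vY ?orbT].
have yD : y \in D by rewrite -Qc mem_previous.
have xD : last c X \in D by rewrite -Qc' mem_previous.
have xD' : last c X \in D' by rewrite -Pc' mem_previous // !mem_cat !inE eqxx !orbT.
have hD' : last (mate p) Y \in D' by rewrite -Pp mem_previous.
have sO u b : u != mate c -> s (inl (u, b)) = (u, b) by rewrite /s => /negbTE ->.
have sy b : s (inl (y, b)) = (last (mate p) Y, b).
  rewrite /y; case E: Y => [|z Y1]; first by rewrite /s /= eqxx.
  rewrite sO //=; apply: contra c'O => /eqP <-.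
  by rewrite mem_cat E mem_last orbT.
have sc b : s (inl (c, b)) = (c, b) by rewrite sO // passage_eqE /= andbF.
have sc' b : s (inl (mate c, b)) = (mate p, b) by rewrite /s /= eqxx.
have [s0 s1] : s (inr 0%N) = (p, false) /\ s (inr 1%N) = (q, true) by [].
clearbody y.
have Kp i := @same_face_corner D' p i pD' isT.
have Kq i := @same_face_corner D' (mate q) i q'D' isT.
have a2 : same_face D' (mate q, true) (last (mate p) Y, false).
  by have := Kp 1%N isT; rewrite /= Pp Pp'.
have b1 : same_face D' (mate c, true) (q, true).
  by have := Kq 0%N isT; rewrite /= Pq' mateK.
have b2 : same_face D' (p, true) (mate c, false).
  by have := Kq 1%N isT; rewrite /= mateK Pq Pq'.
have b3 : same_face D' (mate q, false) (p, false).
  by have := Kq 2%N isT; rewrite /= mateK Pq.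
have b4 : same_face D' (q, false) (mate q, true).
  by have := Kq 3%N isT; rewrite /= mateK.
have c4 : same_face D' (mate c, false) (c, true).
  by have := @same_face_corner D' c 3%N cD' isT isT.
have Dc i := @same_face_corner D c i cD isT.
have d1 : same_face D (y, true) (mate c, true) by have := Dc 0%N isT; rewrite /= Qc.
have d2 : same_face D (last c X, true) (y, false).
  by have := Dc 1%N isT; rewrite /= Qc Qc'.
have d3 : same_face D (c, false) (last c X, false) by have := Dc 2%N isT; rewrite /= Qc'.
have d4 : same_face D (mate c, false) (c, true) by have := Dc 3%N isT.
clearbody s; apply: (@has_faces_extend D D' k 2 r s).
- move=> u b /DO[->|->|uO]; first by rewrite sc rc.
    by rewrite sc' rp'.
  by rewrite sO ?rO ?OD' //; apply: contraNneq c'O => <-.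
- by move=> [|[|j]] // _; rewrite ?s0 ?s1 ?rp ?rq.
- move=> u b /D'O[||uO]; last by rewrite rO //= OD.
    rewrite !inE => /or3P[] /eqP ->; case: b;
      by rewrite ?rp ?rq ?rc.
  rewrite !inE => /or3P[] /eqP ->; case: b;
    by rewrite ?rp' ?rq' ?rc'.
- move=> u b /D'O[||uO].
  + rewrite !inE => /or3P[] /eqP ->; case: b; rewrite ?rp ?rq ?rc ?sc ?sy ?s0 ?s1;
      try exact: rst_refl.
      exact: rst_trans b2 c4.
    exact: rst_trans b4 a2.
  + rewrite !inE => /or3P[] /eqP ->; case: b; rewrite ?rp' ?rq' ?rc' ?sc ?sc' ?sy ?s0 ?s1;
      by [| apply: rst_refl].
  by rewrite rO // sO; [apply: rst_refl | apply: contraNneq c'O => <-].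
- move=> x z [v [/D'O + sv xz]] => -[||vO'].
  + rewrite !inE => /or3P[] /eqP vE; move: sv xz; rewrite vE // !inE => _.
      rewrite Pp Pp' => /or4P[] /eqP[-> ->]; rewrite ?rlast ?rp ?rp' ?rq' //; exact: rst_refl.
    rewrite Pc Pc' => /or4P[] /eqP[-> ->]; rewrite ?rlastX ?rc ?rc' ?rq //; exact: rst_refl.
  + rewrite !inE => /or3P[] /eqP vE; move: sv xz; rewrite vE // !inE mateK Pq Pq' => _.
    by move=> /or4P[] /eqP[-> ->]; rewrite ?rp ?rq ?rc' ?rq' //; apply: rst_refl.
  exact: corner_transported (OD v vO') sv (transp v vO') xz.
move=> a b [v [/DO + sv ab]] => -[vE|vE|vO'].
- move: ab; rewrite vE !inE Qc Qc' => /or4P[] /eqP[-> ->].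
  + exists (last (mate p) Y, true), (mate p, true); rewrite rlast rp'; split=> //.
    by have := @corner_nth D' p 0%N pD' isT isT; rewrite /= Pp.
  + exists (last c X, true), (q, false); rewrite rlastX rq; split=> //.
    by have := @corner_nth D' c 1%N cD' isT isT; rewrite /= Pc Pc'.
  + exists (c, false), (last c X, false); rewrite rlastX rc; split=> //.
    by have := @corner_nth D' c 2%N cD' isT isT; rewrite /= Pc'.
  exists (mate p, false), (p, true); rewrite rp rp'; split=> //.
  by have := @corner_nth D' p 3%N pD' isT isT.
- by move: sv; rewrite vE.
exact: corner_lifted (OD' v vO') (OD' _ (mO v vO')) sv (transp v vO') ab.
Qed.

(** * Virtual twist knots *)

Definition clasp (N : nat) (o : bool) : passage := Passage N false (Some o).
Definition virtual_clasp (N : nat) : passage := Passage N.+1 true None.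

(** The shadow is that of a twist knot: [2 m + 1] antiparallel crossings and, in the
middle, the first passage [K] through the clasp.  The sides alternate in the
twist region; making only every other crossing real keeps one side, so that all
real chords add up in the index of the clasp chord. *)
Fixpoint twist (b : bool) (N m : nat) (K : seq passage) : seq passage :=
  match m with
  | 0 => let c := Passage (N + 2) true None in [:: c] ++ K ++ [:: mate c]
  | m'.+1 =>
      let p := Passage (N + m'.*2 + 3) true (if b then Some false else None) in
      let q := Passage (N + m'.*2 + 4) false (if b then None else Some false) in
      [:: p; q] ++ twist b N m' K ++ [:: mate q; mate p]
  end.

(** One of the two crossings of the clasp is virtual: this makes every chord of the
twist region cross the clasp chord and no other. *)
Definition twist_clasp (b : bool) (N m : nat) (o : bool) : seq passage :=
  twist b N m [:: clasp N o; virtual_clasp N] ++ [:: mate (clasp N o); mate (virtual_clasp N)].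

Definition twist_value (b : bool) (m : nat) (o : bool) : laurent :=
  even_monomial (~~ b) 0 *+ m
  + even_monomial (~~ o) (1 + (if b == o then 1 else -1) * m%:Z).

Lemma vertex_mate p : vertex (mate p) = vertex p.
Proof. by []. Qed.

Lemma well_paired_perm D E : perm_eq D E -> well_paired D = well_paired E.
Proof.
move=> DE; rewrite /well_paired (perm_all _ DE); apply: eq_all => p.
by rewrite (permP DE) (perm_mem DE).
Qed.

Lemma well_paired_cons p D : {in D, forall q, vertex q != vertex p} ->
  well_paired D -> well_paired [:: p, mate p & D].
Proof.
move=> fresh wD; have [uD mD eD] := well_pairedP _ wD.
have pD q : q \in D -> (q == p) = false /\ (q == mate p) = false.
  by move=> /fresh vq; split; apply/eqP => qp; rewrite qp eqxx in vq.
apply/well_pairedP; split.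
- rewrite /= inE eq_sym (negbTE (mate_neq p)) /= uD andbT.
  by apply/andP; split; apply/negP => /[dup] /pD []; rewrite eqxx.
- move=> q; rewrite !inE => /or3P[/eqP->|/eqP->|qD]; rewrite ?mateK ?eqxx ?orbT //.
  by rewrite mD ?orbT.
move=> q q'; rewrite !inE => /or3P[/eqP->|/eqP->|qD] /or3P[/eqP->|/eqP->|qD'] //;
  rewrite ?mateK; try by [left | right].
- by move=> vv; have := fresh q' qD'; rewrite vv eqxx.
- by move=> vv; have := fresh q' qD'; rewrite -vv eqxx.
- by move=> vv; have := fresh q qD; rewrite vv eqxx.
- by move=> vv; have := fresh q qD; rewrite vv eqxx.
exact: eD.
Qed.

Section Twist.

Variables (b : bool) (N : nat) (o : bool).

Let K := [:: clasp N o; virtual_clasp N].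

Lemma twist_vertex m p :
  p \in twist b N m K -> (N <= vertex p < N + m.*2 + 3)%N.
Proof.
elim: m => [|m IH].
  by rewrite !inE => /or4P[] /eqP ->; rewrite ?vertex_mate /vertex /=; lia.
rewrite /= !inE mem_cat !inE => /or3P[/eqP->|/eqP->|/orP[/IH|/orP[]/eqP->]];
  rewrite ?vertex_mate /vertex /=; lia.
Qed.

Lemma twist_shape m : exists v l X,
  let c := Passage v true l in twist b N m K = [:: c] ++ X ++ [:: mate c].
Proof.
case: m => [|m]; first by exists (N + 2)%N, None, K.
exists (N + m.*2 + 3)%N, (if b then Some false else None).
exists (Passage (N + m.*2 + 4) false (if b then None else Some false)
  :: twist b N m K ++ [:: mate (Passage (N + m.*2 + 4) false (if b then None else Some false))]).
by rewrite /= -catA.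
Qed.

Variable D : seq passage.
Hypotheses (wD : well_paired D) (D_neq0 : D != [::]).
Hypothesis ltN : {in D, forall p, (vertex p < N)%N}.

Lemma twist_clasp_well_paired m : well_paired (twist_clasp b N m o ++ D).
Proof.
elim: m => [|m IH].
  have -> : well_paired (twist_clasp b N 0 o ++ D) =
     (let c := Passage (N + 2) true None in let k := clasp N o in let k' := virtual_clasp N in
      well_paired [:: c, mate c, k, mate k, k', mate k' & D]).
    by apply/well_paired_perm/permP => P; rewrite /= ; lia.
  do 3 ?[apply: well_paired_cons] => //.
  - move=> p; rewrite !inE; do 4?case/predU1P=> [->|]; rewrite ?vertex_mate /vertex /= ?neq_ltn; try lia.
    by move/ltN; rewrite /vertex; lia.
  - move=> p; rewrite !inE; do 2?case/predU1P=> [->|]; rewrite ?vertex_mate /vertex /= ?neq_ltn; try lia.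
    by move/ltN; rewrite /vertex; lia.
  by move=> p /ltN; rewrite /vertex /=; lia.
set p := Passage (N + m.*2 + 3) true (if b then Some false else None).
set q := Passage (N + m.*2 + 4) false (if b then None else Some false).
have P : perm_eq (twist_clasp b N m.+1 o ++ D)
    [:: p, mate p, q, mate q & twist_clasp b N m o ++ D].
  by apply/permP => P; rewrite /twist_clasp /= -/p -/q !count_cat /= ?count_cat /=; lia.
rewrite (well_paired_perm P).
have lt x : x \in twist_clasp b N m o ++ D -> (vertex x < N + m.*2 + 3)%N.
  rewrite !mem_cat => /orP[/orP[/twist_vertex/andP[] //|]|/ltN]; last lia.
  by rewrite !inE => /orP[] /eqP->; rewrite ?vertex_mate /vertex /=; lia.
apply: well_paired_cons; last first.
  by apply: well_paired_cons => // x /lt; rewrite ?vertex_mate /vertex /=; lia.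
by move=> x; rewrite !inE; do 2?case/predU1P=> [->|]; last move/lt; rewrite ?vertex_mate /vertex /=; lia.
Qed.

Lemma twist_clasp_has_faces m k :
  has_faces D k -> has_faces (twist_clasp b N m o ++ D) (k + 3 + m.*2).
Proof.
move=> Dk; elim: m => [|m IH].
  rewrite addn0; apply: (@has_faces_trefoil D k (N + 2) N N.+1 None (Some o) None) => //.
    by rewrite /= !inE; lia.
  by move=> p /ltN; rewrite !inE; lia.
have [v [l [X E]]] := twist_shape m.
have := @has_faces_triple (twist_clasp b N m o ++ D) (k + 3 + m.*2)
  (N + m.*2 + 3) (N + m.*2 + 4) v
  (if b then Some false else None) (if b then None else Some false) l X
  ([:: mate (clasp N o); mate (virtual_clasp N)] ++ D).
have -> : (k + 3 + m.*2 + 2 = k + 3 + m.+1.*2)%N by lia.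
rewrite /twist_clasp /= -/K E /= -!catA /=; apply => //.
- by have := twist_clasp_well_paired m; rewrite /twist_clasp -/K E /= -!catA.
- lia.
- move=> x xT.
  have : (vertex x < N + m.*2 + 3)%N; last by rewrite !inE; lia.
  have : x \in twist_clasp b N m o ++ D by rewrite /twist_clasp -/K E /= -!catA.
  rewrite !mem_cat => /orP[/orP[/twist_vertex/andP[] //|]|/ltN]; last lia.
  by rewrite !inE => /orP[] /eqP->; rewrite ?vertex_mate /vertex /=; lia.
by move: IH; rewrite /twist_clasp -/K E /= -!catA.
Qed.

Let e2 : endpoint := (N, o, ~~ o).
Let V m := gauss_diagram (twist b N m K).
Let e m : endpoint := (N + m.*2 + (if b then 3 else 4), false, ~~ b)%N.

Lemma gauss_twist0 : V 0 = [:: e2].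
Proof. by rewrite /V /e2 /K; case: (o). Qed.

Lemma gauss_twistS m : V m.+1 = e m :: V m ++ [:: flip (e m)].
Proof.
pose p := Passage (N + m.*2 + 3) true (if b then Some false else None).
pose q := Passage (N + m.*2 + 4) false (if b then None else Some false).
rewrite /V [twist b N m.+1 K](_ : _ = [:: p; q] ++ twist b N m K ++ [:: mate q; mate p]) //.
by rewrite !gauss_diagram_cat /p /q /e; case: (b).
Qed.

Lemma gauss_twist_chord m x : x \in V m -> (N <= chord x < N + m.*2 + 3)%N.
Proof. by rewrite mem_gauss_diagram => /twist_vertex. Qed.

Lemma rise_twist m : rise (V m) = 1.
Proof.
elim: m => [|m IH]; first by rewrite gauss_twist0 /rise big_seq1 /e2; case: (o).
rewrite gauss_twistS /rise big_cons big_cat big_seq1 -/(rise _) IH jump_flip /=.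
by ring.
Qed.

(** The chords of the twist region are nested, and each encloses the first endpoint
of the clasp chord, whose jump is 1: so each of them has index 0.  They all jump
in the same direction before that endpoint, which moves its height by [m]. *)
Lemma index_sum_twist m h y :
  index_sum (lows h (V m) ++ [:: (flip e2, y)])
  = even_monomial (~~ b) 0 *+ m
    + even_monomial (~~ o) (1 + (if o then 1 else -1)
        * (y - h + (if b then 1 else -1) * m%:Z)).
Proof.
elim: m h => [|m IH] h.
  rewrite gauss_twist0 index_sum_pair mulr0n add0r /e2.
  by congr even_monomial; case: (o); case: (b); rewrite /endpoint_side /is_over /=; ring.
rewrite gauss_twistS /=; set x := h - _; rewrite lows_cat rise_twist /=.
set h' := h + jump (e m); set y' := h' + 1 - _.
have P : perm_eq ((e m, x) :: (lows h' (V m) ++ [:: (flip (e m), y')]) ++ [:: (flip e2, y)])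
    ([:: (e m, x); (flip (e m), y')] ++ (lows h' (V m) ++ [:: (flip e2, y)])).
  by apply/permP => P; rewrite /= !count_cat /=; lia.
rewrite (index_sum_perm P) index_sum_cat ?IH.
  rewrite index_sum_pair mulrS -[RHS]addrA; congr (_ + (_ + _)).
    congr even_monomial; rewrite /= /x /y' /h' /jump endpoint_side_flip /e /endpoint_side /is_over /=.
    by case: (b) => /=; ring.
  congr even_monomial; congr (1 + _ * _).
  by rewrite /h' /jump /e /endpoint_side /is_over /=; case: (b) => /=; rewrite -[m.+1]addn1 PoszD; ring.
have out u : (N + m.*2 + (if b then 3 else 4) != chord u.1)%N ->
  forall z, z \in [:: (e m, x); (flip (e m), y')] -> chord z.1 != chord u.1.
  by move=> nu z; rewrite !inE => /orP[] /eqP ->.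
move=> z u zL uL; apply: out zL; move: uL; rewrite mem_cat inE => /orP[/mem_lows|/eqP->] /=.
  move/gauss_twist_chord; move: (chord u.1) => w wN.
  by apply/eqP; move: wN; case: (b); lia.
by rewrite [chord (flip e2)](_ : _ = N) //; apply/eqP; case: (b); lia.
Qed.

Lemma twist_clasp_polynomial m :
  code_polynomial (twist_clasp b N m o ++ D) = code_polynomial D + twist_value b m o.
Proof.
have gE : gauss_diagram (twist_clasp b N m o) = V m ++ [:: flip e2].
  by rewrite /twist_clasp gauss_diagram_cat /e2; congr (_ ++ _); case: (o).
have rF : jump (flip e2) = -1 by rewrite /e2; case: (o).
have sF : endpoint_side (flip e2) = true by rewrite /e2; case: (o).
have lE : lows 0 (gauss_diagram (twist_clasp b N m o))
    = lows 0 (V m) ++ [:: (flip e2, 0)].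
  by rewrite gE lows_cat /= rise_twist sF.
rewrite /code_polynomial gauss_diagram_cat lows_cat index_sum_cat; last first.
  move=> x y /mem_lows; rewrite gE mem_cat inE => xV /mem_lows.
  rewrite mem_gauss_diagram => /ltN /= ltx; apply/eqP => cc.
  have : (N <= chord x.1)%N.
    by case/orP: xV => [/gauss_twist_chord/andP[]|/eqP->].
  by rewrite cc leqNgt ltx.
have -> : rise (gauss_diagram (twist_clasp b N m o)) = 0.
  by rewrite gE rise_cat rise_twist /rise big_seq1 rF.
rewrite lE index_sum_twist addr0 addrC.
congr (_ + (_ + even_monomial _ _)).
by case: (b); case: (o) => /=; ring.
Qed.

End Twist.

(** * The realizable polynomials *)

(** Nonempty codes, because a crossingless circle has no base edge to insert at. *)
Definition realizable (f : laurent) : Prop :=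
  exists2 D, [/\ well_paired D, D != [::] &
    exists2 k, has_faces D k & ((size D)./2 + k = size D + 2)%N]
  & code_polynomial D = f.

Lemma realizable_knot f :
  realizable f -> exists K : virtual_knot, odd_writhe_polynomial K = f.
Proof.
case=> D [wD _ [k fk E]] fE.
have dD : is_diagram D by rewrite /is_diagram wD (has_faces_planar wD fk E).
exists (\pi_virtual_knot%qT (exist _ D dD : diagram)).
by rewrite odd_writhe_polynomial_pi diagram_polynomialE.
Qed.

Lemma size_twist b N m K : size (twist b N m K) = (size K + 2 + 4 * m)%N.
Proof. by elim: m => [|m IH] /=; rewrite ?size_cat /= ?IH; lia. Qed.

Lemma realizable_twist f b m o : realizable f -> realizable (f + twist_value b m o).
Proof.
case=> D [wD D0 [k Dk E]] <-.
pose N := (\max_(p <- D) vertex p).+1.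
have ltN : {in D, forall p, (vertex p < N)%N}.
  by move=> p pD; rewrite ltnS (big_rem p) //= leq_maxl.
exists (twist_clasp b N m o ++ D); last exact: twist_clasp_polynomial.
split; first exact: twist_clasp_well_paired.
  by rewrite -size_eq0 !size_cat size_twist /=; lia.
exists (k + 3 + m.*2)%N; first exact: twist_clasp_has_faces.
rewrite !size_cat size_twist /=; lia.
Qed.

(** A single virtual kink. *)
Lemma realizable0 : realizable 0.
Proof.
pose c := Passage 0 true None; exists [:: c; mate c]; last first.
  by rewrite /code_polynomial /index_sum /= big_nil.
split=> //; exists 3%N => //.
exists (fun x : passage * bool => if side x.1 == x.2 then 2%N else (x.2 == false) : nat).
split.
- by move=> p b _; case: ifP => // _; case: b.
- move=> [|[|[|j]]] // _; [exists (mate c), true | exists c, false | exists c, true];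
    by rewrite !inE eqxx ?orbT.
- move=> x y [v [vD sv]]; have -> : v = c.
    by move: vD sv; rewrite !inE => /orP[] /eqP ->.
  by rewrite !inE => /or4P[] /eqP[-> ->].
have C i := @same_face_corner [:: c; mate c] c i (mem_head _ _) isT.
have c1 : same_face [:: c; mate c] (mate c, false) (c, true) by have := C 3%N isT.
move=> p b p' b'; rewrite !inE => /orP[] /eqP-> /orP[] /eqP->; case: b; case: b' => //= _;
  by [apply: rst_refl | apply: rst_sym | ].
Qed.

Definition const (z : int) : laurent := << z *g 0 >>.

Lemma constD x y : const (x + y) = const x + const y.
Proof. exact: monalgUD. Qed.

Lemma even_monomialE (s : bool) (n : int) :
  even_monomial s (2 * n) = << (if s then 1 else -1) *g 2 * n >>.
Proof. by rewrite /even_monomial ifT //; lia. Qed.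

Lemma twist_valueE b m o :
  twist_value b m o = const ((if b then -1 else 1) * m%:Z)
    + even_monomial (~~ o) (1 + (if b == o then 1 else -1) * m%:Z).
Proof.
rewrite /twist_value; congr (_ + _); rewrite -(mulr0 2) even_monomialE -monalgUMn mulr0.
by congr (<< _ *g _ >>); case: b => /=; rewrite -mulr_natr; lia.
Qed.

(** Two chords in the twist region: the index of the clasp chord is odd, and only
the two constant terms remain. *)
Lemma realizable_even_const z f : realizable f -> realizable (f + const (2 * z)).
Proof.
have step b g : realizable g -> realizable (g + const (if b then -2 else 2)).
  move=> /(realizable_twist b 2 true); rewrite twist_valueE.
  rewrite [even_monomial _ _](_ : _ = 0) ?addr0; first by case: b.
  by rewrite /even_monomial ifF //; apply/negbTE; case: (b) => /=; lia.
have rep b n g : realizable g -> realizable (g + const ((if b then -2 else 2) * n%:Z)).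
  move=> rg; elim: n => [|n IH]; first by rewrite mulr0 /const monalgU0 addr0.
  rewrite -[n.+1]addn1 PoszD mulrDr mulr1 constD addrA; exact: step.
move=> rf; case: (boolP (z < 0)) => z0.
  by have := rep true `|z|%N f rf; rewrite (_ : -2 * _ = 2 * z) //; lia.
by have := rep false `|z|%N f rf; rewrite (_ : 2 * _ = 2 * z) //; lia.
Qed.

(** For [m] odd the clasp chord contributes a monomial of any wanted even exponent and
sign, and the twist region an odd constant, which even constants correct. *)
Lemma realizable_difference (a k : int) f :
  realizable f -> realizable (f + (<< a *g 2 * k >> - const a)).
Proof.
have step s g : realizable g ->
    realizable (g + (<< (if s then 1 else -1) *g 2 * k >> - const (if s then 1 else -1))).
  (* The index of the clasp chord is 1 + m or 1 - m, according to [b]. *)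
  pose m := absz (2 * k - 1)%R; pose b := ((0 <= 2 * k - 1) != s).
  move=> /(realizable_twist b m (~~ s)); rewrite twist_valueE negbK.
  have -> : 1 + (if b == ~~ s then 1 else -1) * m%:Z = 2 * k.
    by rewrite /b /m; case: (boolP (0 <= 2 * k - 1)); case: (s) => /=; lia.
  rewrite even_monomialE => rg.
  (* This constant is even because [m] is odd. *)
  pose z := - ((if s then 1 else -1) + (if b then -1 else 1) * m%:Z).
  have z2 : z = 2 * (z %/ 2)%Z.
    by rewrite /z /m; case: (s); case: (b); lia.
  have := realizable_even_const (z %/ 2)%Z rg; rewrite -z2 -!addrA.
  rewrite [const _ + _](_ : _ = << if s then 1 else -1 *g 2 * k >>
     - const (if s then 1 else -1)) //.
  rewrite addrCA -constD; congr (_ + _); rewrite -[RHS]monalgUN /const.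
  by congr (<< _ *g _ >>); rewrite /z; ring.
have rep s n g : realizable g ->
    realizable (g + (<< (if s then 1 else -1) * n%:Z *g 2 * k >>
      - const ((if s then 1 else -1) * n%:Z))).
  move=> rg; elim: n => [|n IH]; first by rewrite mulr0 /const !monalgU0 subr0 addr0.
  have := step s _ IH; rewrite -[n.+1]addn1 PoszD mulrDr mulr1 monalgUD constD.
  by rewrite -addrA [(_ - _) + (_ - _)]addrACA -opprD.
move=> rf; case: (boolP (a < 0)) => a0.
  by have := rep false `|a|%N f rf; rewrite (_ : -1 * _ = a) //; lia.
by have := rep true `|a|%N f rf; rewrite (_ : 1 * _ = a) //; lia.
Qed.

Lemma realizable_even_support (n : int) (m : nat) (a : int -> int) :
    (\sum_(0 <= i < m) a (2 * n - 2 * i%:Z) = 0 %[mod 2])%Z ->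
  realizable (\sum_(0 <= i < m) << a (2 * n - 2 * i%:Z) *g (2 * n - 2 * i%:Z) >>).
Proof.
set S := \sum_(0 <= i < m) _ => S2.
have -> : \sum_(0 <= i < m) << a (2 * n - 2 * i%:Z) *g (2 * n - 2 * i%:Z) >>
  = \sum_(0 <= i < m) (<< a (2 * n - 2 * i%:Z) *g 2 * (n - i%:Z) >>
      - const (a (2 * n - 2 * i%:Z))) + const S.
  rewrite sumrB /const [in RHS](raddf_sum (mkmalgU 0)) subrK.
  by apply: eq_bigr => i _; rewrite mulrBr.
have -> : S = 2 * (S %/ 2)%Z by lia.
apply: realizable_even_const.
elim: m {S S2} => [|m IH]; first by rewrite big_nil; apply: realizable0.
by rewrite big_nat_recr //=; apply: realizable_difference.
Qed.

(** * Necessity of the parity conditions *)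

Lemma sum_odd n : (\sum_(0 <= i < n) odd i)%N = n./2.
Proof.
elim: n => [|n IH]; first by rewrite big_nil.
by rewrite big_nat_recr //= IH; lia.
Qed.

Definition over_index (G : seq endpoint) (e : endpoint) : int := 1 + low G (flip e) - low G e.

(** Half of the positions are odd.  A chord whose endpoints have positions of
different parities takes one odd position, and an odd chord takes none or two, so
the number of odd chords is even. *)
Lemma even_chords G : gauss_wf G ->
  ~~ odd (\sum_(e <- G | is_over e) (2 %| over_index G e)%Z).
Proof.
move=> wfG; have [uG flG _] := wfG.
have parity e : e \in G -> ((2 %| over_index G e)%Z : nat) + odd (index e G) + odd (index (flip e) G)
    = 1 %[mod 2].
  move=> eG; have i1 : (index e G < size G)%N by rewrite index_mem.
  have i2 : (index (flip e) G < size G)%N by rewrite index_mem flG.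
  have := height_parity (ltnW i1); have := height_parity (ltnW i2).
  rewrite /over_index /low endpoint_side_flip; move: (height _ _) (height _ _) => x y.
  by case: (endpoint_side e) => /=; case: (boolP (2 %| _)%Z); lia.
(* Positions run through [0, size G), and half of them are odd. *)
have half : (\sum_(e <- G) odd (index e G) = (size G)./2)%N.
  case: (G) uG => [|x0 G']; first by rewrite big_nil.
  move=> uG'; rewrite (big_nth x0) -sum_odd big_nat [RHS]big_nat.
  by apply: eq_bigr => i /andP[_ lt]; rewrite index_uniq.
have sz : (size G = (\sum_(e <- G | is_over e) 1).*2)%N.
  rewrite -sum1_size (big_chords wfG) -mul2n big_distrr /=.
  by apply: eq_bigr.
rewrite (big_chords wfG) sz doubleK in half.
have : (\sum_(e <- G | is_over e) ((2 %| over_index G e)%Z + (odd (index e G) + odd (index (flip e) G)))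
   = \sum_(e <- G | is_over e) 1 %[mod 2])%N.
  rewrite big_seq_cond [in RHS]big_seq_cond.
  elim/big_rec2: _ => // e x y /andP[eG _] xy.
  by have := parity e eG; lia.
rewrite big_split /= half; lia.
Qed.

(** The window [-2 M, 2 M] contains every even exponent up to [M] exactly once. *)
Lemma sum_even_window (V : nmodType) (F : int -> V) (M : nat) (x : int) :
    (`|x| <= M)%N ->
  \sum_(0 <= i < M.*2.+1) (if x == 2 * M%:Z - 2 * i%:Z then F (2 * M%:Z - 2 * i%:Z) else 0)
  = if (2 %| x)%Z then F x else 0.
Proof.
move=> xM; case: ifP => x2; last first.
  by rewrite big1 // => i _; rewrite ifF //; apply/eqP => xE; move: x2; lia.
pose j := absz (M%:Z - (x %/ 2)%Z)%R.
have jE : x = 2 * M%:Z - 2 * j%:Z by rewrite /j; lia.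
have jM : (j < M.*2.+1)%N by rewrite /j; lia.
rewrite (bigD1_seq j) ?mem_index_iota ?iota_uniq //= -jE eqxx big1 ?addr0 // => i ij.
by rewrite ifF //; apply/eqP => xE; move/eqP: ij; lia.
Qed.

Lemma knot_even_support (K : virtual_knot) :
  exists (n : int) (m : nat) (a : int -> int),
     odd_writhe_polynomial K = \sum_(0 <= i < m.+1)
           << a (2 * n - 2 * i%:Z) *g (2 * n - 2 * i%:Z) >>
     /\ (\sum_(0 <= i < m.+1) a (2 * n - 2 * i%:Z) = 0 %[mod 2])%Z.
Proof.
rewrite /odd_writhe_polynomial diagram_polynomialE /code_polynomial.
have /andP[/gauss_diagram_wf wfG _] := valP (repr K).
move: (gauss_diagram _) wfG => G wfG.
rewrite index_sumE // -/(over_index G _).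
pose M := (\sum_(e <- G) `|over_index G e|)%N.
have leM e : e \in G -> (`|over_index G e| <= M)%N.
  by move=> eG; rewrite /M (big_rem e) //= leq_addr.
pose w (e : endpoint) : int := if e.2 then 1 else -1.
pose a z := \sum_(e <- G | is_over e) (if over_index G e == z then w e else 0).
exists M%:Z, M.*2, a; split.
- pose F e z : laurent := << w e *g z >>.
  transitivity (\sum_(e <- G | is_over e) \sum_(0 <= i < M.*2.+1)
     (if over_index G e == 2 * M%:Z - 2 * i%:Z then F e (2 * M%:Z - 2 * i%:Z) else 0)).
    rewrite big_seq_cond [RHS]big_seq_cond; apply: eq_bigr => e /andP[eG _].
    by rewrite sum_even_window ?leM.
  rewrite exchange_big /=; apply: eq_bigr => i _; rewrite /a (raddf_sum (mkmalgU _)) /=.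
  by apply: eq_bigr => e _; case: ifP => // _; rewrite monalgU0.
rewrite /a exchange_big /=.
have -> : \sum_(e <- G | is_over e) \sum_(0 <= i < M.*2.+1)
     (if over_index G e == 2 * M%:Z - 2 * i%:Z then w e else 0)
   = \sum_(e <- G | is_over e) (if (2 %| over_index G e)%Z then w e else 0).
  rewrite big_seq_cond [RHS]big_seq_cond; apply: eq_bigr => e /andP[eG _].
  exact: (sum_even_window (fun=> w e) (leM e eG)).
have : (\sum_(e <- G | is_over e) (if (2 %| over_index G e)%Z then w e else 0)
    = (\sum_(e <- G | is_over e) (2 %| over_index G e)%Z)%N%:Z %[mod 2])%Z.
  elim/big_rec2: _ => // e x y _ xy.
  by rewrite /w; case: ifP => _; case: (e.2); lia.
by have := even_chords wfG; lia.
Qed.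

Theorem theorem5p1 (f : laurent) :
  (exists K : virtual_knot, odd_writhe_polynomial K = f) <->
  (exists (n : int) (m : nat) (a : int -> int),
     f = \sum_(0 <= i < m.+1)
           << a (2 * n - 2 * i%:Z) *g (2 * n - 2 * i%:Z) >>
     /\ (\sum_(0 <= i < m.+1) a (2 * n - 2 * i%:Z) = 0 %[mod 2])%Z).
Proof.
split=> [[K <-] | [n [m [a [-> a2]]]]]; first exact: knot_even_support.
by apply: realizable_knot; apply: realizable_even_support.
Qed.
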